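(* Let $\varphi(z)=1+B_1z+B_2z^2+B_3z^3+\cdots$ be a Ma–Minda function with $B_1^2\ge B_2$, let $f\in\mathcal{S}^*(\varphi)$, and put $$\mu=\frac{4B_1(B_1^2+3B_1-B_2)}{(3B_1^2-B_2)(B_1^2+B_2)+B_1(2B_1^2-2B_2-B_1)}.$$ Then the following inequalities hold. (1) If $\mu\notin[0,4]$, then $$\det T_{3,1}(f)\ge\min\left\{1-\frac{B_1^2}{4},\ 1-2B_1^2+\frac{3B_1^4}{4}+\frac{B_1^2B_2}{2}-\frac{B_2^2}{4}\right\}.$$ (2) If $\mu=4$, then $$\det T_{3,1}(f)\ge 1-2B_1^2+\frac{3B_1^4}{4}+\frac{B_1^2B_2}{2}-\frac{B_2^2}{4}.$$ (3) If $\mu\in(0,4)$, then $$\det T_{3,1}(f)\ge 1-\frac{B_1^2}{4}-\frac{B_1^2(B_1^2+3B_1-B_2)^2}{4\left(B_1(2B_1^2-B_1-2B_2)+(3B_1^2-B_2)(B_1^2+B_2)\right)}.$$ The first two inequalities, (1) and (2), are sharp.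
   Context: $\mathbb{D}=\{z\in\mathbb{C}:|z|<1\}$. $\mathcal{A}$ is the class of analytic functions $f(z)=z+a_2z^2+a_3z^3+\cdots$ on $\mathbb{D}$. A Ma–Minda function is an analytic univalent function $\varphi$ on $\mathbb{D}$ with positive real part, $\varphi(0)=1$, $\varphi'(0)>0$, such that $\varphi(\mathbb{D})$ is starlike with respect to $1$ and symmetric about the real axis (so the coefficients $B_n$ are real and $B_1>0$). $\mathcal{S}^*(\varphi)=\{f\in\mathcal{A}: zf'(z)/f(z)\prec\varphi(z)\}$, where $\prec$ denotes subordination: $h\prec\varphi$ means $h=\varphi\circ\omega$ for some analytic $\omega:\mathbb{D}\to\mathbb{D}$ with $\omega(0)=0$. For $f(z)=z+a_2z^2+a_3z^3+\cdots$, the third order Hermitian–Toeplitz determinant is $$\det T_{3,1}(f)=\begin{vmatrix}1&a_2&a_3\\ \bar a_2&1&a_2\\ \bar a_3&\bar a_2&1\end{vmatrix}=2\,\mathrm{Re}(a_2^2\bar a_3)-2|a_2|^2-|a_3|^2+1.$$ An inequality is sharp if, for each $\varphi$ satisfying its hypotheses, equality is attained by some function in the class. *)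

(* Defs.v *)
(* Stdlib reals with Coquelicot's complex numbers. *)
From Stdlib Require Import Reals Lra.
From Coquelicot Require Import Coquelicot.
Open Scope R_scope.

Definition in_disk (z : C) : Prop := Cmod z < 1.

(* Functions on the unit disk are total functions C -> C; their values outside
   the disk are never used. *)
Definition analytic_on_disk (f : C -> C) : Prop :=
  forall z0 : C, in_disk z0 ->
  exists (r : R) (c : nat -> C), 0 < r /\
    forall z : C, Cmod (z - z0) < r -> is_pseries c (z - z0)%C (f z).

(* f(z) = a_0 + a_1 z + a_2 z^2 + ... throughout the disk. *)
Definition expansion (f : C -> C) (a : nat -> C) : Prop :=
  forall z : C, in_disk z -> is_pseries a z (f z).

Definition image_disk (f : C -> C) (w : C) : Prop :=
  exists z : C, in_disk z /\ w = f z.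

Definition class_A (f : C -> C) : Prop :=
  analytic_on_disk f /\
  exists a : nat -> C, expansion f a /\ a 0%nat = RtoC 0 /\ a 1%nat = RtoC 1.

Record Ma_Minda (phi : C -> C) : Prop := {
  MM_analytic : analytic_on_disk phi;
  MM_univalent : forall z w : C,
    in_disk z -> in_disk w -> phi z = phi w -> z = w;
  MM_positive_real_part : forall z : C, in_disk z -> 0 < Re (phi z);
  MM_value0 : phi (RtoC 0) = RtoC 1;
  MM_deriv0 : exists b : R, 0 < b /\ is_derive phi (RtoC 0) (RtoC b);
  MM_starlike : forall (w : C) (t : R), image_disk phi w -> 0 <= t <= 1 ->
    image_disk phi (RtoC 1 + RtoC t * (w - RtoC 1))%C;
  MM_symmetric : forall w : C, image_disk phi w -> image_disk phi (Cconj w)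
}.

Definition subordinate (h phi : C -> C) : Prop :=
  exists omega : C -> C,
    analytic_on_disk omega /\
    (forall z : C, in_disk z -> in_disk (omega z)) /\
    omega (RtoC 0) = RtoC 0 /\
    (forall z : C, in_disk z -> h z = phi (omega z)).

(* z f'(z) / f(z), with its removable singularity at 0 filled in: for
   f(z) = z + a_2 z^2 + ... the limit there is 1. C_derive takes the difference
   quotient's limit along the horizontal direction only; it is used on analytic
   f, where it is the complex derivative. *)
Definition log_deriv (f : C -> C) (z : C) : C :=
  if Ceq_dec z (RtoC 0) then RtoC 1 else (z * C_derive f z / f z)%C.

(* Division by 0 is total, so the requirement that z f'/f have no pole in the
   disk is stated separately. *)
Definition class_S (phi f : C -> C) : Prop :=
  class_A f /\
  (forall z : C, in_disk z -> z <> RtoC 0 -> f z <> RtoC 0) /\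
  subordinate (log_deriv f) phi.

Definition det3 (m11 m12 m13 m21 m22 m23 m31 m32 m33 : C) : C :=
  (m11 * (m22 * m33 - m23 * m32)
   - m12 * (m21 * m33 - m23 * m31)
   + m13 * (m21 * m32 - m22 * m31))%C.

Definition det_T31 (a : nat -> C) : C :=
  det3 (RtoC 1)           (a 2%nat)           (a 3%nat)
       (Cconj (a 2%nat))  (RtoC 1)            (a 2%nat)
       (Cconj (a 3%nat))  (Cconj (a 2%nat))   (RtoC 1).

(* In particular the determinant is real, so Re loses nothing below. *)
Lemma det_T31_real (a : nat -> C) :
  det_T31 a =
  RtoC (2 * Re (a 2%nat * a 2%nat * Cconj (a 3%nat))%C
        - 2 * Cmod (a 2%nat) ^ 2 - Cmod (a 3%nat) ^ 2 + 1).
Proof.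
unfold det_T31, det3, Cmod.
destruct (a 2%nat) as [x y], (a 3%nat) as [u v].
rewrite !pow2_sqrt by (simpl; nra).
unfold Re, RtoC, Cconj, Cplus, Cminus, Copp, Cmult; simpl.
f_equal; ring.
Qed.

Definition det_T31_ge (phi : C -> C) (m : R) : Prop :=
  forall (f : C -> C) (a : nat -> C),
    class_S phi f -> expansion f a -> Re (det_T31 a) >= m.

Definition det_T31_attains (phi : C -> C) (m : R) : Prop :=
  exists (f : C -> C) (a : nat -> C),
    class_S phi f /\ expansion f a /\ Re (det_T31 a) = m.

(* If the denominator vanishes, this is 0 by the convention / 0 = 0,
   a value excluded by each of the cases mu not in [0,4], mu = 4, mu in (0,4). *)
Definition mu (B1 B2 : R) : R :=
  4 * B1 * (B1 ^ 2 + 3 * B1 - B2) /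
  ((3 * B1 ^ 2 - B2) * (B1 ^ 2 + B2) + B1 * (2 * B1 ^ 2 - 2 * B2 - B1)).

(* Main.v *)
Require Import Defs.
From Stdlib Require Import Wf_nat Reals Lra Lia Psatz Classical ClassicalEpsilon.
From Coquelicot Require Import Coquelicot.
Open Scope R_scope.

(** Write z f'(z) / f(z) = phi(omega(z)) with omega(z) = w1 z + w2 z^2 + ... mapping the
    disk to itself. Comparing coefficients gives a_2 = B_1 w1 and
    2 a_3 = B_1 w2 + (B_1^2 + B_2) w1^2 ([class_S_coefficients]). In the determinant the
    term that depends on the argument of w2 is B_1 (B_1^2 - B_2) / 2 times the real part of
    w1^2 conj(w2); since B_1^2 >= B_2, and since |w2| <= 1 - |w1|^2 by the Schwarz-Pick
    inequality, the determinant is at least a quadratic polynomial g(t) of t = |w1|^2,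
    which lies in [0,1] ([lower_envelope], [det_lower_envelope]). The vertex of g is mu / 4.
    If mu is in (0,4), g is bounded below by its value at the vertex. Otherwise g is
    concave or decreasing on [0,1], and its minimum is g(0) or g(1). Equality at g(1)
    holds for omega(z) = z and equality at g(0) for omega(z) = z^2.

    Two analytic facts carry this. The first is the Schwarz-Pick inequality for the first
    two coefficients ([schwarz_pick_coefficients]). It follows from the maximum principle,
    applied to omega(z) / z and then to a Moebius transform of it divided by z. A function
    that is given by local power series only has a second-order Taylor expansion with cubic
    error at each point (a [jet]), a property stable under products, inverses and
    composition, and that is all the maximum principle needs: the mean of |F|^2 over four
    points z0 + i^k t exceeds |F(z0)|^2 up to an error of order t^3, so that
    |F|^2 + eps |z|^2 has no interior maximum ([smooth_no_strict_max]).

    The second is the existence, for a given omega, of f with z f' / f = phi o omega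
    ([class_S_construct]). With phi(omega(z)) = 1 + p_1 z + p_2 z^2 + ..., the function f
    is z E(z), where E' = (p_1 + p_2 z + ...) E and E(0) = 1, so that the coefficients of E
    are given by a recursion, and a geometric majorant shows that E converges in the whole
    disk. The series built in the same way from - p is 1 / E, because their product has
    derivative 0; hence E has no zero. That f is analytic at each point of the disk
    requires re-expanding a power series about another centre ([pseries_recenter]). *)

(** * Series of complex numbers *)

Notation Cseries := (@is_series C_AbsRing C_NormedModule).
Notation Cpseries := (@is_pseries C_AbsRing C_NormedModule).
Notation Csum := (@sum_n C_AbelianMonoid).

Lemma Cmod_triangle_minus : forall x y : C, Cmod (x - y) <= Cmod x + Cmod y.
Proof.
intros x y. unfold Cminus. rewrite <- (Cmod_opp y). apply Cmod_triangle.
Qed.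

Lemma Cmult_reg_l : forall c x y : C, c <> RtoC 0 -> (c * x = c * y)%C -> x = y.
Proof.
intros c x y Hc H. replace x with (/ c * (c * x))%C by (field; exact Hc).
rewrite H. field. exact Hc.
Qed.

Lemma Cminus_eq_0 : forall x y : C, (x - y)%C = RtoC 0 -> x = y.
Proof. intros x y H. replace x with (x - y + y)%C by ring. rewrite H. ring. Qed.

Lemma RtoC_neq_0 : forall x : R, x <> 0 -> RtoC x <> RtoC 0.
Proof. intros x Hx H. apply Hx. now apply RtoC_inj. Qed.

Lemma Cmod_RtoC_pos : forall x : R, 0 <= x -> Cmod (RtoC x) = x.
Proof. intros x Hx. rewrite Cmod_R. now apply Rabs_pos_eq. Qed.

Lemma Cmod_pow : forall (z : C) n, Cmod (z ^ n)%C = Cmod z ^ n.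
Proof.
intros z n; induction n as [|n IH]; simpl.
- apply Cmod_1.
- now rewrite Cmod_mult, IH.
Qed.

Lemma Cpow_n : forall (z : C) n, @pow_n C_Ring z n = (z ^ n)%C.
Proof. intros z n; induction n as [|n IH]; simpl; [reflexivity | now rewrite IH]. Qed.

Lemma Csum_Sn : forall (a : nat -> C) n, Csum a (S n) = (Csum a n + a (S n))%C.
Proof. intros a n. rewrite (@sum_Sn C_AbelianMonoid). reflexivity. Qed.

Lemma Csum_O : forall (a : nat -> C), Csum a 0 = a 0%nat.
Proof. intros a. apply (@sum_O C_AbelianMonoid). Qed.

Lemma Cseries_eps : forall (a : nat -> C) (l : C),
  Cseries a l <->
  forall eps, 0 < eps ->
    exists N, forall n, (N <= n)%nat -> Cmod (Csum a n - l) < eps.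
Proof.
intros a l; split.
- intros H eps Heps.
  assert (Heps2 : 0 < eps / 2) by lra.
  assert (Hs : sqrt 2 < 2).
  { rewrite <- (sqrt_pow2 2) at 2 by lra. apply sqrt_lt_1; lra. }
  destruct (H (fun y => Cmod (y - l) < eps)) as [N HN].
  + exists (mkposreal _ Heps2). intros y Hy.
    apply (C_NormedModule_mixin_compat2 l y) in Hy. simpl in Hy.
    change (minus y l) with (y - l)%C in Hy. nra.
  + exists N. exact HN.
- intros H P [eps HP].
  destruct (H eps (cond_pos eps)) as [N HN].
  exists N. intros n Hn. apply HP.
  apply (C_NormedModule_mixin_compat1 l). apply HN, Hn.
Qed.

Lemma Cseries_unique : forall (a : nat -> C) (l l' : C),
  Cseries a l -> Cseries a l' -> l = l'.
Proof.
intros a l l' H H'.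
apply (@filterlim_locally_unique _ C_AbsRing C_NormedModule eventually _ (Csum a) l l' H H').
Qed.

Lemma Cseries_ext : forall (a b : nat -> C) (l : C),
  (forall n, a n = b n) -> Cseries a l -> Cseries b l.
Proof. intros a b l. apply (@is_series_ext C_AbsRing C_NormedModule). Qed.

Lemma Cseries_minus : forall (a b : nat -> C) (la lb : C),
  Cseries a la -> Cseries b lb -> Cseries (fun n => a n - b n)%C (la - lb)%C.
Proof. intros a b la lb. apply (@is_series_minus C_AbsRing C_NormedModule). Qed.

Lemma Cseries_scal : forall (c : C) (a : nat -> C) (l : C),
  Cseries a l -> Cseries (fun n => c * a n)%C (c * l)%C.
Proof. intros c a l. apply (@is_series_scal C_AbsRing C_NormedModule). Qed.

Lemma Cseries_tail : forall (a : nat -> C) (l : C),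
  Cseries (fun n => a (S n)) (l - a 0%nat)%C -> Cseries a l.
Proof. intros a l. apply (@is_series_decr_1 C_AbsRing C_NormedModule). Qed.

Lemma Cseries_tail_inv : forall (a : nat -> C) (l : C),
  Cseries a l -> Cseries (fun n => a (S n)) (l - a 0%nat)%C.
Proof.
intros a l H. apply (@is_series_incr_1 C_AbsRing C_NormedModule).
change (Cseries a ((l - a 0%nat) + a 0%nat)%C).
replace (l - a 0%nat + a 0%nat)%C with l by ring. exact H.
Qed.

Lemma Cseries_bounded_terms : forall (a : nat -> C) (l : C),
  Cseries a l -> exists M, forall n, Cmod (a n) <= M.
Proof.
intros a l H.
destruct (@filterlim_bounded C_AbsRing C_NormedModule (Csum a)) as [M HM].
- exists l. exact H.
- change (forall n, Cmod (Csum a n) <= M) in HM.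
  assert (M0 : 0 <= M) by (eapply Rle_trans; [apply Cmod_ge_0 | apply (HM 0%nat)]).
  exists (M + M). intros [|n].
  + specialize (HM 0%nat). rewrite Csum_O in HM. lra.
  + replace (a (S n)) with (Csum a (S n) - Csum a n)%C by (rewrite Csum_Sn; ring).
    eapply Rle_trans; [apply Cmod_triangle_minus|].
    generalize (HM n) (HM (S n)); lra.
Qed.

Lemma geometric_sum_le : forall q n, 0 <= q < 1 -> sum_f_R0 (fun k => q ^ k) n <= / (1 - q).
Proof.
intros q n Hq. rewrite tech3 by lra.
unfold Rdiv. rewrite <- (Rmult_1_l (/ (1 - q))) at 2.
apply Rmult_le_compat_r.
- left; apply Rinv_0_lt_compat; lra.
- generalize (pow_le q (S n) (proj1 Hq)); lra.
Qed.

Lemma Csum_geometric_bound : forall (a : nat -> C) K q,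
  0 <= q < 1 -> (forall n, Cmod (a n) <= K * q ^ n) ->
  forall n, Cmod (Csum a n) <= K / (1 - q).
Proof.
intros a K q Hq Ha n.
assert (K0 : 0 <= K).
{ generalize (Ha 0%nat) (Cmod_ge_0 (a 0%nat)); simpl; lra. }
apply Rle_trans with (K * sum_f_R0 (fun k => q ^ k) n).
- induction n as [|n IH].
  + rewrite Csum_O. apply (Ha 0%nat).
  + rewrite Csum_Sn. eapply Rle_trans; [apply Cmod_triangle|].
    simpl sum_f_R0. rewrite Rmult_plus_distr_l.
    apply Rplus_le_compat; [exact IH | apply (Ha (S n))].
- apply Rmult_le_compat_l; [exact K0 | apply geometric_sum_le, Hq].
Qed.

Lemma Cseries_geometric_bound : forall (a : nat -> C) (l : C) K q,
  0 <= q < 1 -> (forall n, Cmod (a n) <= K * q ^ n) ->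
  Cseries a l -> Cmod l <= K / (1 - q).
Proof.
intros a l K q Hq Ha Hl.
apply Rnot_lt_le; intros Hlt.
destruct (proj1 (Cseries_eps a l) Hl (Cmod l - K / (1 - q))) as [N HN]; [lra|].
specialize (HN N (le_n N)).
generalize (Csum_geometric_bound a K q Hq Ha N).
generalize (Cmod_triangle_minus (Csum a N) (Csum a N - l)).
replace (Csum a N - (Csum a N - l))%C with l by ring. lra.
Qed.

Lemma Cseries_geometric_conv : forall (a : nat -> C) K q,
  0 <= q < 1 -> (forall n, Cmod (a n) <= K * q ^ n) -> exists l, Cseries a l.
Proof.
intros a K q Hq Ha.
apply (@ex_series_le C_AbsRing C_CompleteNormedModule a (fun n => K * q ^ n)).
- exact Ha.
- exists (K * / (1 - q)).
  apply (@is_series_scal R_AbsRing R_NormedModule).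
  apply is_series_geom. rewrite Rabs_pos_eq; lra.
Qed.

(** * Power series *)

Lemma Cseries_of_pseries : forall (a : nat -> C) (z l : C),
  Cpseries a z l -> Cseries (fun n => a n * z ^ n)%C l.
Proof.
intros a z l H. refine (Cseries_ext _ _ l _ H). intros n.
change (@pow_n C_Ring z n * a n = a n * z ^ n)%C. rewrite Cpow_n. ring.
Qed.

Lemma Cpseries_of_series : forall (a : nat -> C) (z l : C),
  Cseries (fun n => a n * z ^ n)%C l -> Cpseries a z l.
Proof.
intros a z l H.
refine (Cseries_ext _ (fun n => @pow_n C_Ring z n * a n)%C l _ H). intros n.
symmetry. change (@pow_n C_Ring z n * a n = a n * z ^ n)%C. rewrite Cpow_n. ring.
Qed.

Lemma Cpseries_unique : forall (a : nat -> C) (z l l' : C),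
  Cpseries a z l -> Cpseries a z l' -> l = l'.
Proof. intros a z l l'. apply Cseries_unique. Qed.

Lemma Cpseries_0 : forall a : nat -> C, Cpseries a (RtoC 0) (a 0%nat).
Proof.
intros a. apply Cpseries_of_series, Cseries_eps. intros eps Heps.
exists 0%nat. intros n _.
replace (Csum _ n) with (a 0%nat).
- replace (a 0%nat - a 0%nat)%C with (RtoC 0) by ring. now rewrite Cmod_0.
- induction n as [|n IH].
  + rewrite Csum_O. simpl. ring.
  + rewrite Csum_Sn, <- IH. simpl. ring.
Qed.

Lemma Cpseries_tail : forall (a : nat -> C) (z l : C),
  Cpseries (fun n => a (S n)) z l -> Cpseries a z (a 0%nat + z * l)%C.
Proof.
intros a z l H. apply Cpseries_of_series, Cseries_tail.
apply Cseries_of_pseries, (Cseries_scal z) in H.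
replace (a 0%nat + z * l - a 0%nat * z ^ 0)%C with (z * l)%C by (simpl; ring).
revert H. apply Cseries_ext. intros n. simpl. ring.
Qed.

Lemma Cpseries_tail_inv : forall (a : nat -> C) (z l : C),
  z <> RtoC 0 -> Cpseries a z l -> Cpseries (fun n => a (S n)) z ((l - a 0%nat) / z)%C.
Proof.
intros a z l Hz H. apply Cseries_of_pseries, Cseries_tail_inv, (Cseries_scal (/ z)%C) in H.
apply Cpseries_of_series.
replace ((l - a 0%nat) / z)%C with (/ z * (l - a 0%nat * z ^ 0))%C
  by (simpl; field; exact Hz).
revert H. apply Cseries_ext. intros n. simpl. field. exact Hz.
Qed.

Definition geometrically_bounded (a : nat -> C) (r K : R) : Prop :=
  forall n, Cmod (a n) * r ^ n <= K.

Lemma geometrically_bounded_le : forall a r K n,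
  0 < r -> geometrically_bounded a r K -> Cmod (a n) <= K * (/ r) ^ n.
Proof.
intros a r K n Hr H.
apply Rmult_le_reg_r with (r ^ n); [apply pow_lt, Hr|].
rewrite Rmult_assoc, <- Rpow_mult_distr, Rinv_l, pow1, Rmult_1_r by lra.
apply H.
Qed.

Lemma geometrically_bounded_terms : forall a r K (z : C) n,
  0 < r -> geometrically_bounded a r K ->
  Cmod (a n * z ^ n)%C <= K * (Cmod z / r) ^ n.
Proof.
intros a r K z n Hr H.
rewrite Cmod_mult, Cmod_pow. unfold Rdiv.
rewrite Rpow_mult_distr, (Rmult_comm (Cmod z ^ n)), <- Rmult_assoc.
apply Rmult_le_compat_r; [apply pow_le, Cmod_ge_0|].
now apply geometrically_bounded_le.
Qed.

Lemma ratio_bounds : forall (z : C) r, Cmod z < r -> 0 <= Cmod z / r < 1.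
Proof.
intros z r Hz. generalize (Cmod_ge_0 z); intros H0.
split.
- apply Rdiv_le_0_compat; lra.
- apply Rlt_div_l; lra.
Qed.

Lemma geometrically_bounded_pseries : forall a r K (z l : C),
  geometrically_bounded a r K -> Cmod z < r -> Cpseries a z l ->
  Cmod l <= K / (1 - Cmod z / r).
Proof.
intros a r K z l Ha Hz Hl. apply Cseries_of_pseries in Hl.
generalize (Cmod_ge_0 z); intros H0.
refine (Cseries_geometric_bound _ _ _ _ _ _ Hl).
- now apply ratio_bounds.
- intros n. apply geometrically_bounded_terms; [lra | exact Ha].
Qed.

(** Total, with an unspecified value where the series diverges. *)
Definition pseries (a : nat -> C) (z : C) : C :=
  epsilon (inhabits (RtoC 0)) (fun l => Cpseries a z l).

Lemma pseries_unique : forall (a : nat -> C) (z l : C), Cpseries a z l -> pseries a z = l.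
Proof.
intros a z l H. unfold pseries.
apply Cpseries_unique with a z; [|exact H].
apply (epsilon_spec (inhabits (RtoC 0)) (fun l => Cpseries a z l)).
now exists l.
Qed.

Lemma pseries_correct : forall a r K (z : C),
  geometrically_bounded a r K -> Cmod z < r -> Cpseries a z (pseries a z).
Proof.
intros a r K z Ha Hz. unfold pseries.
apply (epsilon_spec (inhabits (RtoC 0)) (fun l => Cpseries a z l)).
generalize (Cmod_ge_0 z); intros H0.
destruct (Cseries_geometric_conv (fun n => a n * z ^ n)%C K (Cmod z / r)) as [l Hl].
- now apply ratio_bounds.
- intros n. apply geometrically_bounded_terms; [lra | exact Ha].
- exists l. now apply Cpseries_of_series.
Qed.

Lemma Cpseries_geometrically_bounded : forall (a : nat -> C) (z l : C),
  Cpseries a z l -> exists K, geometrically_bounded a (Cmod z) K.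
Proof.
intros a z l H. apply Cseries_of_pseries, Cseries_bounded_terms in H.
destruct H as [M HM]. exists M. intros n.
rewrite <- Cmod_pow, <- Cmod_mult. apply HM.
Qed.

(** Convergence in the whole disk. Bounds are used rather than convergence itself, because
    they pass to tails, termwise derivatives and coefficients given by recursion. *)
Definition tame (a : nat -> C) : Prop :=
  forall r, 0 < r < 1 -> exists K, geometrically_bounded a r K.

Lemma expansion_tame : forall f a, expansion f a -> tame a.
Proof.
intros f a H r Hr.
assert (Hm : Cmod (RtoC r) = r) by (rewrite Cmod_R; apply Rabs_pos_eq; lra).
destruct (Cpseries_geometrically_bounded a (RtoC r) (f (RtoC r))) as [K HK].
- apply H. unfold in_disk. lra.
- exists K. now rewrite Hm in HK.
Qed.

Lemma tame_expansion : forall a, tame a -> expansion (pseries a) a.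
Proof.
intros a H z Hz. unfold in_disk in Hz. generalize (Cmod_ge_0 z); intros H0.
destruct (H ((1 + Cmod z) / 2)) as [K HK]; [lra|].
apply (pseries_correct a _ K z HK). lra.
Qed.

Lemma geometrically_bounded_tail : forall a r K, 0 < r ->
  geometrically_bounded a r K -> geometrically_bounded (fun n => a (S n)) r (K / r).
Proof.
intros a r K Hr H n. apply (proj1 (Rle_div_r _ _ _ Hr)).
specialize (H (S n)). simpl in H. lra.
Qed.

Lemma tame_tail : forall a, tame a -> tame (fun n => a (S n)).
Proof.
intros a H r Hr. destruct (H r Hr) as [K HK].
exists (K / r). apply geometrically_bounded_tail; [lra | exact HK].
Qed.

(** Each term of 1 + q + ... + q^n is at least q^n. *)
Lemma linear_geometric_bound : forall q n, 0 <= q < 1 -> INR (S n) * q ^ n <= / (1 - q).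
Proof.
intros q n Hq. eapply Rle_trans; [|apply (geometric_sum_le q n Hq)].
induction n as [|n IH].
- simpl. lra.
- rewrite S_INR, Rmult_plus_distr_r, Rmult_1_l. simpl sum_f_R0.
  apply Rplus_le_compat_r. eapply Rle_trans; [|exact IH].
  apply Rmult_le_compat_l; [apply pos_INR|].
  simpl. generalize (pow_le q n (proj1 Hq)); nra.
Qed.

Lemma tame_linear : forall a, tame a -> tame (fun n => RtoC (INR (S n)) * a n)%C.
Proof.
intros a H r Hr.
set (s := (1 + r) / 2).
assert (Hs : r < s < 1) by (unfold s; lra).
destruct (H s) as [K HK]; [lra|].
assert (Hq : 0 <= r / s < 1).
{ split; [apply Rdiv_le_0_compat; lra | apply Rlt_div_l; lra]. }
exists (K * / (1 - r / s)). intros n.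
rewrite Cmod_mult, Cmod_R, Rabs_pos_eq by apply pos_INR.
replace (INR (S n) * Cmod (a n) * r ^ n)
  with ((Cmod (a n) * s ^ n) * (INR (S n) * (r / s) ^ n)).
- apply Rmult_le_compat.
  + apply Rmult_le_pos; [apply Cmod_ge_0 | apply pow_le; lra].
  + apply Rmult_le_pos; [apply pos_INR | apply pow_le; lra].
  + apply HK.
  + now apply linear_geometric_bound.
- unfold Rdiv. rewrite Rpow_mult_distr, pow_inv. field. apply pow_nonzero; lra.
Qed.

(** * Re-expansion about another centre *)

(** The coefficients of (f(z) - f(z0)) / (z - z0) for f(z) = a_0 + a_1 z + ... *)
Definition divided_difference (a : nat -> C) (z0 : C) (n : nat) : C :=
  pseries (fun m => a (S n + m)%nat) z0.

Lemma geometrically_bounded_shift : forall a r K n,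
  0 < r -> geometrically_bounded a r K ->
  geometrically_bounded (fun m => a (n + m)%nat) r (K / r ^ n).
Proof.
intros a r K n Hr H m.
apply (proj1 (Rle_div_r _ _ _ (pow_lt r n Hr))).
rewrite Rmult_assoc, <- pow_add, (Nat.add_comm m n). apply H.
Qed.

Section DividedDifference.

Variables (a : nat -> C) (r K : R) (z0 : C).
Hypothesis Ha : geometrically_bounded a r K.
Hypothesis Hz0 : Cmod z0 < r.

Let Hr : 0 < r.
Proof. generalize (Cmod_ge_0 z0). lra. Qed.

Lemma divided_difference_pseries : forall n,
  Cpseries (fun m => a (S n + m)%nat) z0 (divided_difference a z0 n).
Proof.
intros n. apply (pseries_correct _ r (K / r ^ S n)); [|exact Hz0].
now apply geometrically_bounded_shift.
Qed.

(** The radius r is kept; only the constant grows, by a factor that does not depend on the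
    sequence. Iterating the operation therefore gives a geometric bound. *)
Lemma divided_difference_bounded :
  geometrically_bounded (divided_difference a z0) r (K / (r - Cmod z0)).
Proof.
intros n.
assert (H := geometrically_bounded_pseries _ r (K / r ^ S n) z0 _
  (geometrically_bounded_shift a r K (S n) Hr Ha) Hz0 (divided_difference_pseries n)).
assert (Hp := pow_lt r n Hr).
apply Rle_trans with (K / r ^ S n / (1 - Cmod z0 / r) * r ^ n).
- apply Rmult_le_compat_r; [lra | exact H].
- right. simpl. field. repeat split; lra.
Qed.

(** Synthetic division by z - z0, run from infinity downwards. *)
Lemma divided_difference_rec : forall n,
  divided_difference a z0 n = (a (S n) + z0 * divided_difference a z0 (S n))%C.
Proof.
intros n. apply pseries_unique.
replace (a (S n)) with (a (S n + 0)%nat) by (f_equal; lia).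
apply (Cpseries_tail (fun m => a (S n + m)%nat)).
apply Cpseries_of_series, Cseries_ext with (fun m => a (S (S n) + m)%nat * z0 ^ m)%C.
- intros m. now replace (S n + S m)%nat with (S (S n) + m)%nat by lia.
- apply Cseries_of_pseries, divided_difference_pseries.
Qed.

Lemma divided_difference_0 : pseries a z0 = (a 0%nat + z0 * divided_difference a z0 0)%C.
Proof. apply pseries_unique, Cpseries_tail, divided_difference_pseries. Qed.

Lemma divided_difference_spec : forall z, Cmod z < r ->
  pseries a z = (pseries a z0 + (z - z0) * pseries (divided_difference a z0) z)%C.
Proof.
intros z Hz. rewrite divided_difference_0.
set (b := divided_difference a z0).
assert (HB := pseries_correct b r _ z divided_difference_bounded Hz).
set (B := pseries b z) in *.
apply pseries_unique, Cpseries_of_series, Cseries_tail.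
apply Cseries_of_pseries in HB.
assert (HB' := Cseries_tail_inv _ _ HB).
assert (H := Cseries_minus _ _ _ _ (Cseries_scal z _ _ HB) (Cseries_scal z0 _ _ HB')).
replace (a 0%nat + z0 * b 0%nat + (z - z0) * B - a 0%nat * z ^ 0)%C
  with (z * B - z0 * (B - b 0%nat * z ^ 0))%C by (simpl; ring).
revert H. apply Cseries_ext. intros n.
unfold b. rewrite (divided_difference_rec n). simpl. ring.
Qed.

End DividedDifference.

Fixpoint iterated_difference (a : nat -> C) (z0 : C) (k : nat) : nat -> C :=
  match k with
  | O => a
  | S k => divided_difference (iterated_difference a z0 k) z0
  end.

(** Newton's form of the Taylor coefficient: dividing k times by z - z0 and evaluating at z0
    avoids binomial sums and the exchange of two summations. *)
Definition taylor_coef (a : nat -> C) (z0 : C) (k : nat) : C :=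
  pseries (iterated_difference a z0 k) z0.

Lemma iterated_difference_bounded : forall a r K z0 k,
  geometrically_bounded a r K -> Cmod z0 < r ->
  geometrically_bounded (iterated_difference a z0 k) r (K / (r - Cmod z0) ^ k).
Proof.
intros a r K z0 k Ha Hz0. induction k as [|k IH].
- simpl. now rewrite Rdiv_1_r.
- replace (K / (r - Cmod z0) ^ S k) with (K / (r - Cmod z0) ^ k / (r - Cmod z0)).
  + simpl. now apply divided_difference_bounded.
  + simpl. field. split; [apply pow_nonzero|]; lra.
Qed.

Lemma taylor_remainder : forall a r K z0 z,
  geometrically_bounded a r K -> Cmod z0 < r -> Cmod z < r ->
  forall n, pseries a z =
   (Csum (fun k => taylor_coef a z0 k * (z - z0) ^ k) n
     + (z - z0) ^ S n * pseries (iterated_difference a z0 (S n)) z)%C.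
Proof.
intros a r K z0 z Ha Hz0 Hz n. induction n as [|n IH].
- rewrite Csum_O. unfold taylor_coef. simpl.
  rewrite (divided_difference_spec a r K z0 Ha Hz0 z Hz) at 1. ring.
- rewrite Csum_Sn, IH.
  assert (Hn := iterated_difference_bounded a r K z0 (S n) Ha Hz0).
  rewrite (divided_difference_spec _ r _ z0 Hn Hz0 z Hz) at 1.
  unfold taylor_coef. simpl. ring.
Qed.

(** After n + 1 divisions the remainder is at most a constant times
    (|z - z0| / (r - |z0|))^(n+1). *)
Lemma pseries_recenter : forall a r K z0 z,
  geometrically_bounded a r K -> Cmod z0 < r -> Cmod (z - z0) < r - Cmod z0 ->
  Cpseries (taylor_coef a z0) (z - z0)%C (pseries a z).
Proof.
intros a r K z0 z Ha Hz0 Hh.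
assert (Hz : Cmod z < r).
{ generalize (Cmod_triangle z0 (z - z0)).
  replace (z0 + (z - z0))%C with z by ring. lra. }
apply Cpseries_of_series, Cseries_eps. intros eps Heps.
set (s := r - Cmod z0) in *.
set (q := Cmod (z - z0) / s).
assert (Hq : 0 <= q < 1) by (apply ratio_bounds; exact Hh).
set (M := K / (1 - Cmod z / r)).
assert (HM : forall n,
  Cmod (Csum (fun k => taylor_coef a z0 k * (z - z0) ^ k)%C n - pseries a z)
    <= q ^ S n * M).
{ intros n. rewrite (taylor_remainder a r K z0 z Ha Hz0 Hz n).
  assert (Hn := iterated_difference_bounded a r K z0 (S n) Ha Hz0).
  fold s in Hn.
  assert (Hb := geometrically_bounded_pseries _ r _ z _ Hn Hz
    (pseries_correct _ r _ z Hn Hz)).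
  match goal with |- Cmod (?A - (?A + ?B)) <= _ =>
    replace (A - (A + B))%C with (- B)%C by ring end.
  rewrite Cmod_opp, Cmod_mult, Cmod_pow.
  replace (q ^ S n * M)
    with (Cmod (z - z0) ^ S n * (K / s ^ S n / (1 - Cmod z / r))).
  - apply Rmult_le_compat_l; [apply pow_le, Cmod_ge_0 | exact Hb].
  - unfold q, M, Rdiv. rewrite Rpow_mult_distr, pow_inv. ring. }
assert (HM0 : 0 <= M).
{ apply Rle_trans with (Cmod (pseries a z)); [apply Cmod_ge_0|].
  apply (geometrically_bounded_pseries a r K z); trivial.
  now apply (pseries_correct a r K). }
destruct (pow_lt_1_zero q) with (y := eps / (M + 1)) as [N HN].
- rewrite Rabs_pos_eq; lra.
- apply Rdiv_lt_0_compat; lra.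
- exists N. intros n Hn. eapply Rle_lt_trans; [apply HM|].
  specialize (HN (S n)). rewrite Rabs_pos_eq in HN by (apply pow_le; lra).
  apply Rle_lt_trans with (q ^ S n * (M + 1)).
  + apply Rmult_le_compat_l; [apply pow_le|]; lra.
  + apply Rlt_div_r; [lra|]. apply HN. lia.
Qed.

Lemma expansion_recenter : forall f a z0, expansion f a -> in_disk z0 ->
  exists r, 0 < r /\
    forall z, Cmod (z - z0) < r -> Cpseries (taylor_coef a z0) (z - z0)%C (f z).
Proof.
intros f a z0 Hf Hz0. unfold in_disk in Hz0.
generalize (Cmod_ge_0 z0); intros H0.
set (r := (1 + Cmod z0) / 2).
assert (Hr : Cmod z0 < r < 1) by (unfold r; lra).
destruct (expansion_tame f a Hf r) as [K HK]; [lra|].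
exists (r - Cmod z0). split; [lra|]. intros z Hz.
assert (Hzr : Cmod z < r).
{ generalize (Cmod_triangle z0 (z - z0)).
  replace (z0 + (z - z0))%C with z by ring. lra. }
rewrite <- (pseries_unique a z (f z)).
- apply (pseries_recenter a r K); lra || assumption.
- apply Hf. unfold in_disk. lra.
Qed.

Lemma expansion_analytic : forall f a, expansion f a -> analytic_on_disk f.
Proof.
intros f a Hf z0 Hz0.
destruct (expansion_recenter f a z0 Hf Hz0) as [r Hr].
now exists r, (taylor_coef a z0).
Qed.

(** The first Taylor coefficient at z0 is the sum of b_n z0^n, where
    a_(n+1) = b_n - z0 b_(n+1). Summation by parts turns the sum of (n+1) a_(n+1) z0^n,
    the termwise derivative, into it. *)
Lemma taylor_coef_1 : forall a z0, tame a -> in_disk z0 ->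
  taylor_coef a z0 1 = pseries (fun n => RtoC (INR (S n)) * a (S n))%C z0.
Proof.
intros a z0 Ha Hz0. unfold in_disk in Hz0.
unfold taylor_coef. cbn [iterated_difference].
assert (Hb : tame (divided_difference a z0)).
{ intros r Hr. set (s := (1 + Rmax r (Cmod z0)) / 2).
  assert (Hm := Rmax_l r (Cmod z0)). assert (Hm' := Rmax_r r (Cmod z0)).
  assert (Hm1 : Rmax r (Cmod z0) < 1) by (apply Rmax_lub_lt; lra).
  destruct (Ha s) as [K HK]; [unfold s; lra|].
  exists (K / (s - Cmod z0)).
  assert (Hs : Cmod z0 < s) by (unfold s; lra).
  assert (Hd := divided_difference_bounded a s K z0 HK Hs).
  intros n. eapply Rle_trans; [|apply (Hd n)].
  apply Rmult_le_compat_l; [apply Cmod_ge_0|].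
  apply pow_incr. unfold s. lra. }
set (b := divided_difference a z0) in *.
assert (Hrec : forall n, b n = (a (S n) + z0 * b (S n))%C).
{ intros n. set (r := (1 + Cmod z0) / 2).
  generalize (Cmod_ge_0 z0); intros H0.
  destruct (Ha r) as [K HK]; [unfold r; lra|].
  apply (divided_difference_rec a r K); [exact HK | unfold r; lra]. }
assert (HB := tame_expansion b Hb z0 Hz0).
assert (HB' := tame_expansion _ (tame_linear b Hb) z0 Hz0).
set (B := pseries b z0) in *.
set (B' := pseries _ z0) in HB'.
symmetry. apply pseries_unique, Cpseries_of_series.
apply Cseries_of_pseries in HB. apply Cseries_of_pseries in HB'.
(* B' is the sum of (n+1) b_n z0^n. The term n = 0 of B' - B, the sum of n b_n z0^n, is 0;
   without it the index shifts, and B' - B is the sum of (n+1) b_(n+1) z0^(n+1). *)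
assert (HT := Cseries_minus _ _ _ _ HB' HB).
apply Cseries_tail_inv in HT.
assert (HD := Cseries_minus _ _ _ _ HB' HT).
replace B with (B' - (B' - B - (RtoC (INR 1) * b 0%nat * z0 ^ 0 - b 0%nat * z0 ^ 0)))%C
  by (simpl; ring).
revert HD. apply Cseries_ext. intros n.
rewrite (S_INR (S n)), RtoC_plus, (Hrec n).
change (z0 ^ S n)%C with (z0 * z0 ^ n)%C.
generalize (RtoC (INR (S n))). intros c. ring.
Qed.

(** * Second-order jets *)

Definition near0 (P : C -> Prop) : Prop :=
  exists d, 0 < d /\ forall h, Cmod h < d -> P h.

Lemma near0_and : forall P Q : C -> Prop,
  near0 P -> near0 Q -> near0 (fun h => P h /\ Q h).
Proof.
intros P Q [d [Hd HP]] [e [He HQ]]. exists (Rmin d e). split.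
- now apply Rmin_pos.
- intros h Hh. generalize (Rmin_l d e) (Rmin_r d e); intros.
  split; [apply HP | apply HQ]; lra.
Qed.

Lemma near0_imp : forall P Q : C -> Prop,
  (forall h, P h -> Q h) -> near0 P -> near0 Q.
Proof. intros P Q H [d [Hd HP]]. exists d. auto. Qed.

Lemma near0_true : forall P : C -> Prop, (forall h, P h) -> near0 P.
Proof. intros P H. exists 1. split; [lra | auto]. Qed.

(** Cubic error terms are carried as h^3 e(h) with e bounded near 0; then the stability of
    jets under each operation is a polynomial identity. *)
Definition bounded_near0 (e : C -> C) : Prop :=
  exists K, near0 (fun h => Cmod (e h) <= K).

Lemma bounded_const : forall c, bounded_near0 (fun _ => c).
Proof. intros c. exists (Cmod c). apply near0_true. intros; lra. Qed.

Lemma bounded_id : bounded_near0 (fun h => h).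
Proof. exists 1, 1. split; [lra | intros; lra]. Qed.

Lemma bounded_plus : forall e e', bounded_near0 e -> bounded_near0 e' ->
  bounded_near0 (fun h => e h + e' h)%C.
Proof.
intros e e' [K HK] [K' HK']. exists (K + K').
refine (near0_imp _ _ _ (near0_and _ _ HK HK')).
intros h [H H']. eapply Rle_trans; [apply Cmod_triangle | lra].
Qed.

Lemma bounded_mult : forall e e', bounded_near0 e -> bounded_near0 e' ->
  bounded_near0 (fun h => e h * e' h)%C.
Proof.
intros e e' [K HK] [K' HK']. exists (K * K').
refine (near0_imp _ _ _ (near0_and _ _ HK HK')).
intros h [H H']. rewrite Cmod_mult.
apply Rmult_le_compat; trivial; apply Cmod_ge_0.
Qed.

Lemma bounded_opp : forall e, bounded_near0 e -> bounded_near0 (fun h => - e h)%C.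
Proof.
intros e [K HK]. exists K. refine (near0_imp _ _ _ HK).
intros h H. now rewrite Cmod_opp.
Qed.

Lemma bounded_minus : forall e e', bounded_near0 e -> bounded_near0 e' ->
  bounded_near0 (fun h => e h - e' h)%C.
Proof. intros e e' H H'. apply bounded_plus; [|apply bounded_opp]; assumption. Qed.

Ltac bounded := repeat first
  [ assumption | apply bounded_const | apply bounded_id
  | apply bounded_plus | apply bounded_minus | apply bounded_mult | apply bounded_opp ].

Lemma bounded_small : forall e, bounded_near0 e -> forall eps, 0 < eps ->
  near0 (fun h => Cmod (h * e h) < eps).
Proof.
intros e [K [d [Hd HK]]] eps Heps.
assert (K0 : 0 <= K).
{ apply Rle_trans with (Cmod (e (RtoC 0))); [apply Cmod_ge_0|].
  apply HK. now rewrite Cmod_0. }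
exists (Rmin d (eps / (K + 1))). split.
- apply Rmin_pos; [exact Hd | apply Rdiv_lt_0_compat; lra].
- intros h Hh.
  generalize (Rmin_l d (eps / (K + 1))) (Rmin_r d (eps / (K + 1))); intros H1 H2.
  rewrite Cmod_mult.
  assert (Hh' : Cmod h < eps / (K + 1)) by lra.
  apply (proj2 (Rlt_div_r _ _ (K + 1) ltac:(lra))) in Hh'.
  generalize (Cmod_ge_0 h) (HK h ltac:(lra)). nra.
Qed.

Definition jet (F : C -> C) (c0 c1 c2 : C) : Prop :=
  exists e, bounded_near0 e /\
    near0 (fun h => F h = c0 + c1 * h + c2 * (h * h) + h * h * h * e h)%C.

Lemma jet_0 : forall F c0 c1 c2, jet F c0 c1 c2 -> F (RtoC 0) = c0.
Proof.
intros F c0 c1 c2 [e [_ [d [Hd H]]]].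
rewrite H by (now rewrite Cmod_0). ring.
Qed.

Lemma jet_ext : forall F G c0 c1 c2,
  near0 (fun h => F h = G h) -> jet F c0 c1 c2 -> jet G c0 c1 c2.
Proof.
intros F G c0 c1 c2 H [e [He HF]]. exists e. split; [exact He|].
refine (near0_imp _ _ _ (near0_and _ _ H HF)).
intros h [E EF]. now rewrite <- E.
Qed.

Lemma jet_const : forall c, jet (fun _ => c) c (RtoC 0) (RtoC 0).
Proof.
intros c. exists (fun _ => RtoC 0). split; [bounded|].
apply near0_true. intros h. ring.
Qed.

Lemma jet_plus : forall F G a0 a1 a2 b0 b1 b2,
  jet F a0 a1 a2 -> jet G b0 b1 b2 ->
  jet (fun h => F h + G h)%C (a0 + b0)%C (a1 + b1)%C (a2 + b2)%C.
Proof.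
intros F G a0 a1 a2 b0 b1 b2 [e [He HF]] [e' [He' HG]].
exists (fun h => e h + e' h)%C. split; [bounded|].
refine (near0_imp _ _ _ (near0_and _ _ HF HG)).
intros h [-> ->]. ring.
Qed.

Lemma jet_mult : forall F G a0 a1 a2 b0 b1 b2,
  jet F a0 a1 a2 -> jet G b0 b1 b2 ->
  jet (fun h => F h * G h)%C
    (a0 * b0)%C (a0 * b1 + a1 * b0)%C (a0 * b2 + a1 * b1 + a2 * b0)%C.
Proof.
intros F G a0 a1 a2 b0 b1 b2 [e [He HF]] [e' [He' HG]].
exists (fun h => (a1 * b2 + a2 * b1) + h * (a2 * b2)
  + (a0 + a1 * h + a2 * (h * h)) * e' h + e h * (b0 + b1 * h + b2 * (h * h))
  + h * h * h * e h * e' h)%C.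
split; [bounded|].
refine (near0_imp _ _ _ (near0_and _ _ HF HG)).
intros h [-> ->]. ring.
Qed.

Lemma jet_small : forall F c0 c1 c2, jet F c0 c1 c2 -> forall eps, 0 < eps ->
  near0 (fun h => Cmod (F h - c0) < eps).
Proof.
intros F c0 c1 c2 [e [He HF]] eps Heps.
assert (Hb : bounded_near0 (fun h => c1 + c2 * h + h * h * e h)%C) by bounded.
refine (near0_imp _ _ _ (near0_and _ _ HF (bounded_small _ Hb eps Heps))).
intros h [-> H].
replace (_ - c0)%C with (h * (c1 + c2 * h + h * h * e h))%C by ring. exact H.
Qed.

(** The coefficients q1 and q2 solve (b0 + b1 h + b2 h^2) (1 / b0 + q1 h + q2 h^2) = 1
    up to order 3; the bound on the error needs |G| >= |b0| / 2 near 0. *)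
Lemma jet_inv : forall G b0 b1 b2, b0 <> RtoC 0 -> jet G b0 b1 b2 ->
  exists q1 q2, jet (fun h => / G h)%C (/ b0)%C q1 q2.
Proof.
intros G b0 b1 b2 Hb0 HG.
assert (Hb : 0 < Cmod b0) by now apply Cmod_gt_0.
assert (Hsmall := jet_small _ _ _ _ HG (Cmod b0 / 2) ltac:(lra)).
assert (Hlow : near0 (fun h => Cmod b0 / 2 <= Cmod (G h))).
{ refine (near0_imp _ _ _ Hsmall). intros h H.
  generalize (Cmod_triangle_minus (G h) (G h - b0)).
  replace (G h - (G h - b0))%C with b0 by ring. intros; lra. }
assert (Hne : near0 (fun h => G h <> RtoC 0)).
{ refine (near0_imp _ _ _ Hlow). intros h H E. rewrite E, Cmod_0 in H. lra. }
assert (Hinv : bounded_near0 (fun h => / G h)%C).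
{ exists (/ (Cmod b0 / 2)). refine (near0_imp _ _ _ (near0_and _ _ Hlow Hne)).
  intros h [H H']. rewrite Cmod_inv by exact H'.
  apply Rinv_le_contravar; lra. }
destruct HG as [e [He HG]].
set (q1 := (- b1 / (b0 * b0))%C).
set (q2 := ((b1 * b1 - b0 * b2) / (b0 * b0 * b0))%C).
exists q1, q2.
exists (fun h => - / G h * (b1 * q2 + b2 * q1 + h * (b2 * q2)
   + (/ b0 + q1 * h + q2 * (h * h)) * e h))%C.
split; [bounded|].
refine (near0_imp _ _ _ (near0_and _ _ HG Hne)).
intros h [E N].
apply Cmult_reg_l with (G h); [exact N|].
transitivity (G h * (/ b0 + q1 * h + q2 * (h * h))
  - h * h * h * (b1 * q2 + b2 * q1 + h * (b2 * q2)
   + (/ b0 + q1 * h + q2 * (h * h)) * e h))%C.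
- rewrite Cinv_r by exact N. rewrite E. unfold q1, q2. field. exact Hb0.
- field. split; [exact Hb0 | exact N].
Qed.

Lemma jet_comp : forall F G c0 c1 c2 w1 w2,
  jet F c0 c1 c2 -> jet G (RtoC 0) w1 w2 ->
  jet (fun h => F (G h)) c0 (c1 * w1)%C (c1 * w2 + c2 * (w1 * w1))%C.
Proof.
intros F G c0 c1 c2 w1 w2 [e [[K [d [Hd HK]]] [d' [Hd' HF]]]] HG.
assert (Hs := jet_small _ _ _ _ HG (Rmin d d') (Rmin_pos _ _ Hd Hd')).
assert (Hs' : near0 (fun h => Cmod (G h) < d /\ Cmod (G h) < d')).
{ refine (near0_imp _ _ _ Hs). intros h H.
  replace (G h - 0)%C with (G h) in H by ring.
  generalize (Rmin_l d d') (Rmin_r d d'). lra. }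
clear Hs. destruct HG as [f [Hf HG]].
assert (HeG : bounded_near0 (fun h => e (G h))).
{ exists K. refine (near0_imp _ _ _ Hs'). intros h [H _]. now apply HK. }
set (u := fun h => (w2 + h * f h)%C).
assert (Hu : bounded_near0 u) by (unfold u; bounded).
exists (fun h => c1 * f h + c2 * (w1 * u h + w1 * u h + h * (u h * u h))
  + (w1 + h * u h) * (w1 + h * u h) * (w1 + h * u h) * e (G h))%C.
split; [bounded|].
refine (near0_imp _ _ _ (near0_and _ _ HG Hs')).
intros h [E [_ H]]. rewrite (HF _ H).
generalize (e (G h)). intros eg. rewrite E. unfold u. ring.
Qed.

Lemma jet_unique : forall F a0 a1 a2 b0 b1 b2,
  jet F a0 a1 a2 -> jet F b0 b1 b2 -> a0 = b0 /\ a1 = b1 /\ a2 = b2.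
Proof.
assert (Hzero : forall e c, bounded_near0 e ->
  near0 (fun h => h <> RtoC 0 -> c + h * e h = RtoC 0)%C -> c = RtoC 0).
{ intros e c He H. apply Cmod_eq_0, Rle_antisym; [|apply Cmod_ge_0].
  apply Rnot_lt_le. intros Hc.
  destruct (near0_and _ _ H (bounded_small e He (Cmod c) Hc)) as [d [Hd HH]].
  destruct (HH (RtoC (d / 2))) as [H1 H2].
  { rewrite Cmod_R, Rabs_pos_eq; lra. }
  rewrite <- Cmod_opp in H2.
  assert (Hne : RtoC (d / 2) <> RtoC 0) by (apply RtoC_neq_0; lra).
  specialize (H1 Hne).
  replace (- (RtoC (d / 2) * e (RtoC (d / 2))))%C with c in H2; [lra|].
  apply Cminus_eq_0. rewrite <- H1. ring. }
intros F a0 a1 a2 b0 b1 b2 HA HB.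
assert (E0 : a0 = b0) by (rewrite <- (jet_0 _ _ _ _ HA); apply (jet_0 _ _ _ _ HB)).
split; [exact E0|]. rewrite <- E0 in HB. clear E0.
destruct HA as [e [He HA]], HB as [e' [He' HB]].
assert (Hdiff := near0_and _ _ HA HB).
assert (E1 : (a1 - b1 = RtoC 0)%C).
{ apply (Hzero (fun h => (a2 - b2) + h * (e h - e' h))%C); [bounded|].
  refine (near0_imp _ _ _ Hdiff). intros h [H H'] Hh.
  apply Cmult_reg_l with h; [exact Hh|].
  rewrite Cmult_0_r.
  transitivity (F h - F h)%C; [rewrite H at 1; rewrite H'|]; ring. }
apply Cminus_eq_0 in E1.
split; [exact E1|]. subst b1. apply Cminus_eq_0.
{ apply (Hzero (fun h => (e h - e' h))%C); [bounded|].
  refine (near0_imp _ _ _ Hdiff). intros h [H H'] Hh.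
  apply Cmult_reg_l with (h * h)%C; [now apply Cmult_neq_0|].
  rewrite Cmult_0_r.
  transitivity (F h - F h)%C; [rewrite H at 1; rewrite H'|]; ring. }
Qed.

Lemma jet_pseries : forall (c : nat -> C) F r, 0 < r ->
  (forall h, Cmod h < r -> Cpseries c h (F h)) ->
  jet F (c 0%nat) (c 1%nat) (c 2%nat).
Proof.
intros c F r Hr H.
set (s := r / 2).
assert (Hs : Cmod (RtoC s) = s) by (rewrite Cmod_R; apply Rabs_pos_eq; unfold s; lra).
assert (Hs0 : 0 < s < r) by (unfold s; lra).
destruct (Cpseries_geometrically_bounded c (RtoC s) (F (RtoC s))) as [K HK].
{ apply H. lra. }
rewrite Hs in HK.
assert (HK3 := geometrically_bounded_shift c s K 3 (proj1 Hs0) HK).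
set (K3 := K / s ^ 3) in HK3.
exists (pseries (fun n => c (3 + n)%nat)). split.
- exists (K3 / (1 - / 2)), (s / 2). split; [lra|]. intros h Hh.
  assert (K30 : 0 <= K3).
  { generalize (HK3 0%nat) (Cmod_ge_0 (c (3 + 0)%nat)). rewrite pow_O. lra. }
  eapply Rle_trans.
  + apply (geometrically_bounded_pseries _ s K3 h _ HK3); [lra|].
    apply (pseries_correct _ s K3 h HK3). lra.
  + apply Rmult_le_compat_l; [exact K30|].
    assert (Cmod h / s <= / 2).
    { apply Rle_div_l; lra. }
    apply Rinv_le_contravar; lra.
- exists s. split; [lra|]. intros h Hh.
  apply (Cpseries_unique c h); [apply H; lra|].
  assert (HP := pseries_correct _ s K3 h HK3 Hh).
  apply (Cpseries_tail (fun n => c (2 + n)%nat)) in HP.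
  apply (Cpseries_tail (fun n => c (1 + n)%nat)) in HP.
  apply (Cpseries_tail c) in HP.
  match goal with |- Cpseries c h ?x => match type of HP with Cpseries c h ?y =>
    replace x with y end end; [exact HP|].
  simpl. ring.
Qed.

(** * The maximum principle *)

Lemma im_le_Cmod : forall z : C, Rabs (Im z) <= Cmod z.
Proof. intros z. eapply Rle_trans; [apply Rmax_r | apply (Rmax_Cmod z)]. Qed.

Lemma Cmod_le_Re_Im : forall z : C, Cmod z <= Rabs (Re z) + Rabs (Im z).
Proof.
intros z. replace z with (RtoC (Re z) + Ci * RtoC (Im z))%C at 1.
- eapply Rle_trans; [apply Cmod_triangle|].
  rewrite Cmod_mult, !Cmod_R, Cmod_Ci. lra.
- destruct z as [x y]. unfold Re, Im, Ci, RtoC, Cplus, Cmult; simpl.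
  f_equal; ring.
Qed.

(** Compactness of the closed disk in the form of a positive lower bound of the radii: it
    turns a strict inequality that holds near each point into a uniform one. *)
Lemma disk_compact : forall (rho : R) (delta : C -> R),
  (forall z, 0 < delta z) ->
  exists d, 0 < d /\ forall w, Cmod w <= rho ->
    exists z, Cmod z <= rho /\ Cmod (w - z) < delta z /\ d <= delta z.
Proof.
intros rho delta Hdelta.
(* The cover is extended to the square around the disk. At a centre outside the disk the radius is
   so small that the ball misses the disk. The halves pass from the supremum norm to
   the modulus. *)
assert (Hd : forall x y : R, 0 < (if Rle_dec (Cmod (x, y)) rho
   then delta (x, y) / 2 else (Cmod (x, y) - rho) / 2)).
{ intros x y. destruct Rle_dec as [H|H]; [generalize (Hdelta (x, y))|]; lra. }
destruct (compactness_value_2d (- rho) rho (- rho) rho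
  (fun x y => mkposreal _ (Hd x y))) as [d Hcover].
exists d. split; [apply cond_pos|]. intros [x y] Hw.
assert (Hx : Rabs x <= rho) by (apply Rle_trans with (2 := Hw), (re_le_Cmod (x, y))).
assert (Hy : Rabs y <= rho) by (apply Rle_trans with (2 := Hw), (im_le_Cmod (x, y))).
apply Rabs_le_between in Hx. apply Rabs_le_between in Hy.
destruct (NNPP _ (Hcover x y Hx Hy)) as [u [v [_ [_ [Hu [Hv Hdv]]]]]].
cbn [pos] in Hu, Hv, Hdv.
assert (Hm := Cmod_le_Re_Im ((x, y) - (u, v))%C).
simpl in Hm.
change (x + - u) with (x - u) in Hm. change (y + - v) with (y - v) in Hm.
exists (u, v).
destruct Rle_dec as [H|H].
- repeat split; lra || (generalize (Hdelta (u, v)); lra).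
- exfalso.
  generalize (Cmod_triangle_minus (x, y) ((x, y) - (u, v))).
  assert (E : forall p q : C, (p - (p - q) = q)%C) by (intros; ring).
  rewrite E. lra.
Qed.

Definition continuous_on_disk (u : C -> R) (rho : R) : Prop :=
  forall z, Cmod z <= rho -> forall eps, 0 < eps ->
    exists d, 0 < d /\ forall w, Cmod (w - z) < d -> Rabs (u w - u z) < eps.

(** With the local bound u < u(z) + (M - u(z)) / 2, where M is the supremum, a uniform lower
    bound d of the (M - u(z)) / 2 would give u <= M - d on the whole disk if M were not
    attained. The same covering argument with 1 / (1 + |u(z)|) shows that u is bounded. *)
Lemma disk_max : forall (u : C -> R) rho, 0 <= rho -> continuous_on_disk u rho ->
  exists z, Cmod z <= rho /\ forall w, Cmod w <= rho -> u w <= u z.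
Proof.
intros u rho Hrho Hu.
assert (Hcover : forall eps : C -> R,
  (forall z, Cmod z <= rho -> 0 < eps z) -> exists d, 0 < d /\ forall w, Cmod w <= rho ->
    exists z, Cmod z <= rho /\ u w < u z + eps z /\ d <= eps z).
{ intros eps Heps.
  assert (Hex : forall z, exists d, 0 < d /\ (Cmod z <= rho ->
     d <= eps z /\ forall w, Cmod (w - z) < d -> u w < u z + eps z)).
  { intros z. destruct (Rle_dec (Cmod z) rho) as [Hz|Hz].
    - destruct (Hu z Hz (eps z) (Heps z Hz)) as [d [Hd Hdd]].
      exists (Rmin d (eps z)). split; [apply Rmin_pos; auto|].
      intros _. split; [apply Rmin_r|]. intros w Hw.
      generalize (Rmin_l d (eps z)); intros Hm.
      assert (Hwz := Hdd w ltac:(lra)). apply Rabs_lt_between in Hwz. lra.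
    - exists 1. split; [lra|]. intros H; now elim Hz. }
  pose (delta := fun z => proj1_sig (constructive_indefinite_description _ (Hex z))).
  assert (Hdelta : forall z, 0 < delta z /\ (Cmod z <= rho ->
     delta z <= eps z /\ forall w, Cmod (w - z) < delta z -> u w < u z + eps z)).
  { intros z. exact (proj2_sig (constructive_indefinite_description _ (Hex z))). }
  destruct (disk_compact rho delta (fun z => proj1 (Hdelta z))) as [d [Hd Hdd]].
  exists d. split; [exact Hd|]. intros w Hw.
  destruct (Hdd w Hw) as [z [Hz [Hwz Hdz]]]. exists z.
  destruct (proj2 (Hdelta z) Hz) as [H1 H2].
  split; [exact Hz|]. split; [now apply H2 | lra]. }
assert (H00 : Cmod (RtoC 0) <= rho) by (rewrite Cmod_0; exact Hrho).
assert (Hbound : bound (fun y => exists w, Cmod w <= rho /\ y = u w)).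
{ destruct (Hcover (fun z => / (1 + Rabs (u z)))) as [d [Hd Hdd]].
  - intros z _. apply Rinv_0_lt_compat. generalize (Rabs_pos (u z)). lra.
  - exists (/ d + 1). intros y [w [Hw ->]].
    destruct (Hdd w Hw) as [z [Hz [H1 H2]]].
    assert (Hp := Rabs_pos (u z)).
    assert (H3 : 1 + Rabs (u z) <= / d).
    { rewrite <- (Rinv_inv (1 + Rabs (u z))). apply Rinv_le_contravar; lra. }
    assert (/ (1 + Rabs (u z)) <= 1).
    { rewrite <- Rinv_1. apply Rinv_le_contravar; lra. }
    generalize (Rle_abs (u z)). lra. }
destruct (completeness _ Hbound) as [M [HM1 HM2]].
{ exists (u (RtoC 0)), (RtoC 0). now split. }
apply NNPP. intros Hno.
assert (Hlt : forall z, Cmod z <= rho -> u z < M).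
{ intros z Hz. apply Rnot_le_lt. intros Hle. apply Hno.
  exists z. split; [exact Hz|]. intros w Hw.
  apply Rle_trans with M; [|exact Hle]. apply HM1. now exists w. }
destruct (Hcover (fun z => (M - u z) / 2)) as [d [Hd Hdd]].
{ intros z Hz. specialize (Hlt z Hz). lra. }
assert (M <= M - d); [|lra].
apply HM2. intros y [w [Hw ->]].
destruct (Hdd w Hw) as [z [Hz [H1 H2]]]. lra.
Qed.

(** What the maximum principle needs of an analytic function. Unlike analyticity it passes to
    quotients by an elementary computation. *)
Definition smooth_at (F : C -> C) (z0 : C) : Prop :=
  exists c1 c2, jet (fun h => F (z0 + h)%C) (F z0) c1 c2.

Lemma smooth_const : forall c z0, smooth_at (fun _ => c) z0.
Proof. intros c z0. exists (RtoC 0), (RtoC 0). apply jet_const. Qed.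

Lemma smooth_plus : forall F G z0, smooth_at F z0 -> smooth_at G z0 ->
  smooth_at (fun z => F z + G z)%C z0.
Proof.
intros F G z0 [a1 [a2 HF]] [b1 [b2 HG]].
exists (a1 + b1)%C, (a2 + b2)%C. exact (jet_plus _ _ _ _ _ _ _ _ HF HG).
Qed.

Lemma smooth_mult : forall F G z0, smooth_at F z0 -> smooth_at G z0 ->
  smooth_at (fun z => F z * G z)%C z0.
Proof.
intros F G z0 [a1 [a2 HF]] [b1 [b2 HG]].
eexists; eexists. exact (jet_mult _ _ _ _ _ _ _ _ HF HG).
Qed.

Lemma smooth_inv : forall G z0, G z0 <> RtoC 0 -> smooth_at G z0 ->
  smooth_at (fun z => / G z)%C z0.
Proof.
intros G z0 Hne [b1 [b2 HG]].
destruct (jet_inv _ _ _ _ Hne HG) as [q1 [q2 Hq]]. now exists q1, q2.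
Qed.

Lemma smooth_id : forall z0, smooth_at (fun z => z) z0.
Proof.
intros z0. exists (RtoC 1), (RtoC 0), (fun _ => RtoC 0). split; [bounded|].
apply near0_true. intros h. ring.
Qed.

Lemma smooth_ext : forall F G z0, F z0 = G z0 ->
  near0 (fun h => F (z0 + h)%C = G (z0 + h)%C) -> smooth_at F z0 -> smooth_at G z0.
Proof.
intros F G z0 E H [c1 [c2 HF]]. exists c1, c2. rewrite <- E.
exact (jet_ext _ _ _ _ _ H HF).
Qed.

Definition Cmod2 (z : C) : R := Re z ^ 2 + Im z ^ 2.

Lemma Cmod2_Cmod : forall z, Cmod2 z = Cmod z ^ 2.
Proof.
intros z. symmetry. apply Cmod2_alt.
Qed.

(** Parseval's identity for the fourth roots of unity: the degrees 0, 1 and 2 are distinct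
    modulo 4, so that all cross terms cancel. *)
Lemma four_point_mean : forall c0 c1 c2 t : C,
  let P h := Cmod2 (c0 + c1 * h + c2 * (h * h))%C in
  P t + P (Ci * t)%C + P (- t)%C + P (- (Ci * t))%C
   = 4 * (Cmod2 c0 + Cmod2 (c1 * t)%C + Cmod2 (c2 * (t * t))%C).
Proof.
intros [a a'] [b b'] [c c'] [t t'].
unfold Cmod2, Ci, Cplus, Cmult, Copp, Re, Im; simpl. ring.
Qed.

Lemma Cmod2_perturb : forall p r : C, Cmod2 p - 2 * (Cmod p * Cmod r) <= Cmod2 (p + r)%C.
Proof.
intros p r. rewrite !Cmod2_Cmod.
assert (H : Cmod p <= Cmod (p + r) + Cmod r).
{ generalize (Cmod_triangle_minus (p + r) r).
  replace (p + r - r)%C with p by ring. trivial. }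
generalize (Cmod_ge_0 p) (Cmod_ge_0 r) (Cmod_ge_0 (p + r)). intros.
destruct (Rle_dec (Cmod r) (Cmod p)); nra.
Qed.

Lemma Cmod2_close : forall p q : C, Cmod (q - p) <= 1 ->
  Rabs (Cmod2 q - Cmod2 p) <= (2 * Cmod p + 1) * Cmod (q - p).
Proof.
intros p q H. rewrite !Cmod2_Cmod.
assert (H1 : Cmod q <= Cmod p + Cmod (q - p)).
{ generalize (Cmod_triangle p (q - p)).
  replace (p + (q - p))%C with q by ring. trivial. }
assert (H2 : Cmod p <= Cmod q + Cmod (q - p)).
{ generalize (Cmod_triangle_minus q (q - p)).
  replace (q - (q - p))%C with p by ring. trivial. }
generalize (Cmod_ge_0 p) (Cmod_ge_0 q) (Cmod_ge_0 (q - p)). intros.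
apply Rabs_le_between. split; nra.
Qed.

(** The four-point mean of |F|^2 at distance t loses at most a term of order t^3, and that of
    eps |z|^2 gains eps t^2, which wins for small t. *)
Lemma smooth_no_strict_max : forall F z0 eps, smooth_at F z0 -> 0 < eps ->
  ~ near0 (fun h => Cmod2 (F (z0 + h)%C) + eps * Cmod2 (z0 + h)%C
                     <= Cmod2 (F z0) + eps * Cmod2 z0).
Proof.
intros F z0 eps [c1 [c2 [e [[K HK] HF]]]] Heps Hmax.
destruct (near0_and _ _ HK (near0_and _ _ HF Hmax)) as [d [Hd H]].
set (P := Cmod (F z0) + Cmod c1 + Cmod c2).
assert (HP0 : 0 <= P).
{ unfold P. generalize (Cmod_ge_0 (F z0)) (Cmod_ge_0 c1) (Cmod_ge_0 c2). lra. }
assert (K0 : 0 <= K).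
{ eapply Rle_trans; [apply Cmod_ge_0|]. apply (H (RtoC 0)). now rewrite Cmod_0. }
assert (Hlow : forall h, Cmod h < d -> Cmod h <= 1 ->
  Cmod2 (F z0 + c1 * h + c2 * (h * h))%C - 2 * (P * (K * Cmod h ^ 3))
    <= Cmod2 (F (z0 + h)%C)).
{ intros h Hh Hh1. destruct (H h Hh) as [H1 [-> _]].
  eapply Rle_trans; [|apply Cmod2_perturb].
  apply Rplus_le_compat_l, Ropp_le_contravar, Rmult_le_compat_l; [lra|].
  generalize (Cmod_ge_0 h); intros Hh0.
  apply Rmult_le_compat; try apply Cmod_ge_0.
  - eapply Rle_trans; [apply Cmod_triangle|].
    eapply Rle_trans; [apply Rplus_le_compat_r, Cmod_triangle|].
    rewrite !Cmod_mult. unfold P.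
    generalize (Cmod_ge_0 c1) (Cmod_ge_0 c2). intros.
    assert (Cmod h * Cmod h <= 1) by nra.
    assert (Cmod c1 * Cmod h <= Cmod c1) by nra.
    assert (Cmod c2 * (Cmod h * Cmod h) <= Cmod c2) by nra. lra.
  - rewrite !Cmod_mult. rewrite Rmult_comm.
    replace (Cmod h ^ 3) with (Cmod h * Cmod h * Cmod h) by ring.
    apply Rmult_le_compat_r; [|exact H1]. nra. }
set (t := Rmin (Rmin (d / 2) 1) (eps / (4 * P * K + 1))).
assert (Hpos : 0 < 4 * P * K + 1) by (assert (0 <= P * K) by nra; lra).
assert (Ht0 : 0 < t).
{ repeat apply Rmin_pos; try lra. now apply Rdiv_lt_0_compat. }
assert (Ht : t <= d / 2 /\ t <= 1 /\ t <= eps / (4 * P * K + 1)).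
{ unfold t. generalize (Rmin_l (Rmin (d / 2) 1) (eps / (4 * P * K + 1)))
   (Rmin_r (Rmin (d / 2) 1) (eps / (4 * P * K + 1)))
   (Rmin_l (d / 2) 1) (Rmin_r (d / 2) 1). lra. }
destruct Ht as [Ht1 [Ht2 Ht3]].
assert (Hm : Cmod (RtoC t) = t) by (apply Cmod_RtoC_pos; lra).
assert (Hm' : Cmod (Ci * RtoC t)%C = t) by (rewrite Cmod_mult, Cmod_Ci, Hm; ring).
assert (Hall : forall h, Cmod h = t ->
  Cmod2 (F z0 + c1 * h + c2 * (h * h))%C + eps * Cmod2 (z0 + h)%C
    <= Cmod2 (F z0) + eps * Cmod2 z0 + 2 * (P * (K * t ^ 3))).
{ intros h Hh. assert (H1 := Hlow h ltac:(lra) ltac:(lra)).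
  destruct (H h ltac:(lra)) as [_ [_ H2]]. rewrite Hh in H1. lra. }
assert (A1 := Hall (RtoC t) Hm).
assert (A2 := Hall (Ci * RtoC t)%C Hm').
assert (A3 := Hall (- RtoC t)%C ltac:(now rewrite Cmod_opp)).
assert (A4 := Hall (- (Ci * RtoC t))%C ltac:(now rewrite Cmod_opp)).
assert (E1 := four_point_mean (F z0) c1 c2 (RtoC t)).
assert (E2 := four_point_mean z0 (RtoC 1) (RtoC 0) (RtoC t)).
assert (E3 : forall h, (z0 + RtoC 1 * h + RtoC 0 * (h * h) = z0 + h)%C)
  by (intros; ring).
cbv beta zeta in E1, E2. rewrite !E3 in E2. clear E3.
assert (Q1 : 0 <= Cmod2 (c1 * RtoC t)%C) by (rewrite Cmod2_Cmod; apply pow2_ge_0).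
assert (Q2 : 0 <= Cmod2 (c2 * (RtoC t * RtoC t))%C)
  by (rewrite Cmod2_Cmod; apply pow2_ge_0).
assert (Q3 : Cmod2 (RtoC 1 * RtoC t)%C = t ^ 2).
{ rewrite Cmod2_Cmod, Cmod_mult, Hm, Cmod_1. ring. }
assert (Q4 : Cmod2 (RtoC 0 * (RtoC t * RtoC t))%C = 0).
{ rewrite Cmod2_Cmod, Cmod_mult, Cmod_0. ring. }
rewrite Q3, Q4 in E2.
assert (Hfin : eps * t ^ 2 <= 2 * (P * (K * t ^ 3))) by nra.
apply (proj2 (Rle_div_r _ _ _ Hpos)) in Ht3.
assert (0 < t ^ 2) by (apply pow_lt; lra).
assert (eps <= 2 * P * K * t) by (apply Rmult_le_reg_r with (t ^ 2); [lra|]; nra).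
assert (0 <= P * K * t) by (apply Rmult_le_pos; [apply Rmult_le_pos|]; lra).
lra.
Qed.

(** A maximum point of |F|^2 + eps |z|^2 on the closed disk lies on the circle; then eps
    tends to 0. *)
Lemma maximum_principle : forall F rho M, 0 <= rho ->
  (forall z, Cmod z <= rho -> smooth_at F z) ->
  (forall z, Cmod z = rho -> Cmod (F z) <= M) ->
  forall z, Cmod z <= rho -> Cmod (F z) <= M.
Proof.
intros F rho M Hrho HF HM z Hz.
assert (M0 : 0 <= M).
{ apply Rle_trans with (Cmod (F (RtoC rho))); [apply Cmod_ge_0|].
  apply HM. now apply Cmod_RtoC_pos. }
assert (Heps : forall eps, 0 < eps -> Cmod2 (F z) <= M ^ 2 + eps * rho ^ 2).
{ intros eps Heps.
  destruct (disk_max (fun w => Cmod2 (F w) + eps * Cmod2 w) rho Hrho)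
    as [z0 [Hz0 Hmax]].
  - intros w Hw eta Heta.
    set (L := 2 * Cmod (F w) + 1 + eps * (2 * Cmod w + 1)).
    assert (HL : 0 < L).
    { unfold L. generalize (Cmod_ge_0 (F w)) (Cmod_ge_0 w). intros.
      assert (0 <= eps * (2 * Cmod w + 1)) by (apply Rmult_le_pos; lra). lra. }
    destruct (HF w Hw) as [c1 [c2 Hjet]].
    set (eta' := Rmin 1 (eta / L)).
    assert (Heta' : 0 < eta').
    { apply Rmin_pos; [lra | now apply Rdiv_lt_0_compat]. }
    assert (Heta1 : eta' <= 1) by apply Rmin_l.
    assert (HetaL : eta' * L <= eta).
    { apply (proj2 (Rle_div_r _ _ _ HL)). apply Rmin_r. }
    destruct (jet_small _ _ _ _ Hjet eta' Heta') as [d [Hd Hclose]].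
    exists (Rmin d eta'). split; [now apply Rmin_pos|]. intros v Hv.
    generalize (Rmin_l d eta') (Rmin_r d eta'); intros Hm1 Hm2.
    specialize (Hclose (v - w)%C ltac:(lra)). cbv beta in Hclose.
    replace (w + (v - w))%C with v in Hclose by ring.
    assert (B1 := Cmod2_close (F w) (F v) ltac:(lra)).
    assert (B2 := Cmod2_close w v ltac:(lra)).
    apply Rabs_le_between in B1. apply Rabs_le_between in B2.
    generalize (Cmod_ge_0 (F w)) (Cmod_ge_0 w). intros.
    assert ((2 * Cmod (F w) + 1) * Cmod (F v - F w)
      < (2 * Cmod (F w) + 1) * eta') by (apply Rmult_lt_compat_l; lra).
    assert (eps * ((2 * Cmod w + 1) * Cmod (v - w))
      <= eps * ((2 * Cmod w + 1) * eta'))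
      by (repeat apply Rmult_le_compat_l; lra).
    unfold L in HetaL. apply Rabs_lt_between. split; nra.
  - assert (Hedge : Cmod z0 = rho).
    { destruct (Rle_lt_or_eq_dec _ _ Hz0) as [Hlt|]; [exfalso|assumption].
      apply (smooth_no_strict_max F z0 eps (HF z0 Hz0) Heps).
      exists (rho - Cmod z0). split; [lra|]. intros h Hh. apply Hmax.
      generalize (Cmod_triangle z0 h). lra. }
    generalize (Hmax z Hz). rewrite (Cmod2_Cmod z0), (Cmod2_Cmod (F z0)), Hedge.
    assert (Cmod (F z0) ^ 2 <= M ^ 2).
    { apply pow_incr. split; [apply Cmod_ge_0 | now apply HM]. }
    assert (0 <= eps * Cmod2 z).
    { apply Rmult_le_pos; [lra|]. rewrite Cmod2_Cmod. apply pow2_ge_0. }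
    lra. }
apply Rnot_lt_le. intros Hlt.
assert (Hsq : M ^ 2 < Cmod2 (F z)).
{ rewrite Cmod2_Cmod. nra. }
specialize (Heps ((Cmod2 (F z) - M ^ 2) / 2 / (rho ^ 2 + 1))).
assert (Hr1 : 0 < rho ^ 2 + 1) by (generalize (pow2_ge_0 rho); lra).
assert (Hp : 0 < (Cmod2 (F z) - M ^ 2) / 2 / (rho ^ 2 + 1))
  by (apply Rdiv_lt_0_compat; lra).
specialize (Heps Hp).
set (x := (Cmod2 (F z) - M ^ 2) / 2 / (rho ^ 2 + 1)) in *.
assert (x * (rho ^ 2 + 1) = (Cmod2 (F z) - M ^ 2) / 2) by (unfold x; field; lra).
nra.
Qed.

(** * Coefficients of bounded functions *)

Lemma jet_of_series_at : forall (c : nat -> C) f z0 r, 0 < r ->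
  (forall z, Cmod (z - z0) < r -> Cpseries c (z - z0)%C (f z)) ->
  jet (fun h => f (z0 + h)%C) (c 0%nat) (c 1%nat) (c 2%nat).
Proof.
intros c f z0 r Hr H. apply jet_pseries with r; [exact Hr|].
intros h Hh. assert (E : (z0 + h - z0)%C = h) by ring.
rewrite <- E at 1. apply H. now rewrite E.
Qed.

Lemma analytic_smooth : forall f z0, analytic_on_disk f -> in_disk z0 -> smooth_at f z0.
Proof.
intros f z0 Hf Hz0. destruct (Hf z0 Hz0) as [r [c [Hr H]]].
assert (J := jet_of_series_at c f z0 r Hr H).
exists (c 1%nat), (c 2%nat).
assert (E := jet_0 _ _ _ _ J). cbv beta in E.
replace (z0 + 0)%C with z0 in E by ring. now rewrite E.
Qed.

(** The form in which Schwarz's lemma uses the principle: if |z F(z)| <= M, then |F| <= M / rho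
    on the circle of radius rho, for rho as close to 1 as desired. *)
Lemma maximum_principle_open : forall F M, 0 <= M ->
  (forall z, in_disk z -> smooth_at F z) ->
  (forall z, in_disk z -> Cmod z * Cmod (F z) <= M) ->
  forall z, in_disk z -> Cmod (F z) <= M.
Proof.
intros F M HM HF HFM z Hz. unfold in_disk in *.
apply Rnot_lt_le. intros Hlt.
generalize (Cmod_ge_0 z); intros Hz0.
set (m := Rmax (Cmod z) (M / Cmod (F z))).
assert (Hm1 : Cmod z <= m) by apply Rmax_l.
assert (Hm2 : M / Cmod (F z) <= m) by apply Rmax_r.
assert (Hm3 : m < 1) by (apply Rmax_lub_lt; [exact Hz | apply Rlt_div_l; lra]).
set (rho := (1 + m) / 2).
assert (Hrho : m < rho < 1) by (unfold rho; lra).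
assert (H : Cmod (F z) <= M / rho).
{ apply (maximum_principle F rho); try lra.
  - intros w Hw. apply HF. lra.
  - intros w Hw. apply (proj1 (Rle_div_r _ _ rho ltac:(lra))).
    rewrite Rmult_comm, <- Hw. apply HFM. lra. }
apply (proj2 (Rle_div_r _ _ rho ltac:(lra))) in H.
apply (proj1 (Rle_div_l _ _ (Cmod (F z)) ltac:(lra))) in Hm2.
nra.
Qed.

(** The difference quotient at 0 with its removable singularity filled by c. *)
Definition slope (F : C -> C) (c : C) (z : C) : C :=
  if Ceq_dec z (RtoC 0) then c else ((F z - F (RtoC 0)) / z)%C.

Lemma slope_pseries : forall (c : nat -> C) F r, 0 < r ->
  (forall h, Cmod h < r -> Cpseries c h (F h)) ->
  forall h, Cmod h < r -> Cpseries (fun n => c (S n)) h (slope F (c 1%nat) h).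
Proof.
intros c F r Hr H h Hh. unfold slope.
assert (E : F (RtoC 0) = c 0%nat).
{ apply (Cpseries_unique c (RtoC 0)); [apply H; now rewrite Cmod_0 | apply Cpseries_0]. }
destruct Ceq_dec as [->|Hne].
- apply (Cpseries_0 (fun n => c (S n))).
- rewrite E. apply Cpseries_tail_inv; [exact Hne | now apply H].
Qed.

Lemma slope_smooth : forall F c z0, z0 <> RtoC 0 -> smooth_at F z0 ->
  smooth_at (slope F c) z0.
Proof.
intros F c z0 Hz0 HF.
assert (E : forall z, z <> RtoC 0 -> ((F z + - F (RtoC 0)) * / z)%C = slope F c z).
{ intros z Hz. unfold slope. destruct Ceq_dec; [contradiction | reflexivity]. }
apply smooth_ext with (fun z => (F z + - F (RtoC 0)) * / z)%C.
- now apply E.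
- exists (Cmod z0). split; [now apply Cmod_gt_0|]. intros h Hh. apply E.
  intros Habs. replace h with (- z0)%C in Hh.
  + rewrite Cmod_opp in Hh. lra.
  + apply Cminus_eq_0. rewrite <- Copp_0, <- Habs. ring.
- apply smooth_mult.
  + apply smooth_plus; [exact HF | apply smooth_const].
  + apply smooth_inv; [exact Hz0 | apply smooth_id].
Qed.

Lemma smooth_of_pseries : forall (c : nat -> C) F r, 0 < r ->
  (forall h, Cmod h < r -> Cpseries c h (F h)) -> smooth_at F (RtoC 0).
Proof.
intros c F r Hr H. assert (J := jet_pseries c F r Hr H).
exists (c 1%nat), (c 2%nat). rewrite (jet_0 _ _ _ _ J).
refine (jet_ext _ _ _ _ _ _ J). apply near0_true. intros h.
now rewrite Cplus_0_l.
Qed.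

(** The difference of the squares is (1 - |a|^2) (1 - |b|^2). *)
Lemma disk_automorphism_bound : forall a b : C, Cmod a <= 1 -> Cmod b <= 1 ->
  Cmod (a - b) <= Cmod (1 - Cconj b * a).
Proof.
intros a b Ha Hb.
assert (E : Cmod (1 - Cconj b * a) ^ 2 - Cmod (a - b) ^ 2
  = (1 - Cmod a ^ 2) * (1 - Cmod b ^ 2)).
{ rewrite !Cmod2_alt. destruct a as [x y], b as [u v].
  unfold Cminus, Cplus, Cmult, Copp, Cconj, RtoC, Re, Im; simpl. ring. }
generalize (Cmod_ge_0 a) (Cmod_ge_0 b) (Cmod_ge_0 (a - b))
  (Cmod_ge_0 (1 - Cconj b * a)). intros.
assert (0 <= (1 - Cmod a ^ 2) * (1 - Cmod b ^ 2)) by (apply Rmult_le_pos; nra).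
apply Rnot_lt_le. intros Hlt. nra.
Qed.

Lemma limit_bound : forall x y : R, 0 <= x -> 0 <= y ->
  (forall l, 0 < l < 1 -> l * x <= 1 - l ^ 2 * y) -> x <= 1 - y.
Proof.
intros x y Hx Hy H. apply Rnot_lt_le. intros Hlt.
set (D := x + y - 1).
assert (HD : 0 < D) by (unfold D; lra).
set (S := x + 2 * y + 1).
assert (HS : 1 <= S) by (unfold S; lra).
set (eta := Rmin (/ 2) (D / (2 * S))).
assert (H1 : eta <= / 2) by apply Rmin_l.
assert (H2 : eta <= D / (2 * S)) by apply Rmin_r.
assert (H3 : 0 < eta) by (apply Rmin_pos; [lra | apply Rdiv_lt_0_compat; lra]).
apply (proj2 (Rle_div_r _ _ (2 * S) ltac:(lra))) in H2.
specialize (H (1 - eta) ltac:(lra)).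
unfold D, S in *.
assert (0 <= eta ^ 2 * y) by (apply Rmult_le_pos; [apply pow2_ge_0 | lra]).
assert (0 <= eta * x) by (apply Rmult_le_pos; lra).
assert (0 <= eta * y) by (apply Rmult_le_pos; lra).
nra.
Qed.

(** Schwarz's lemma for H(z) = omega(z) / z gives |H| <= 1. For 0 < l < 1, the function
    Q(z) = (l H(z) - l w1) / (z (1 - conj(l w1) l H(z))) is bounded by 1 for the same reason, and
    |Q(0)| = l |w2| / (1 - l^2 |w1|^2). The factor l keeps the denominator from vanishing when
    |w1| = 1; it tends to 1 at the end. *)
Lemma schwarz_pick_coefficients : forall omega,
  analytic_on_disk omega ->
  (forall z, in_disk z -> in_disk (omega z)) ->
  omega (RtoC 0) = RtoC 0 ->
  exists w1 w2, jet omega (RtoC 0) w1 w2 /\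
    Cmod w1 <= 1 /\ Cmod w2 <= 1 - Cmod w1 ^ 2.
Proof.
intros omega Han Hdisk H0.
assert (D0 : in_disk (RtoC 0)) by (unfold in_disk; rewrite Cmod_0; lra).
destruct (Han (RtoC 0) D0) as [r [c [Hr Hc']]].
assert (Hc : forall h, Cmod h < r -> Cpseries c h (omega h)).
{ intros h Hh. assert (E : (h - 0)%C = h) by ring.
  rewrite <- E at 1. apply Hc'. now rewrite E. }
clear Hc'.
assert (J := jet_pseries c omega r Hr Hc).
assert (E0 := jet_0 _ _ _ _ J). rewrite H0 in E0. rewrite <- E0 in J.
set (w1 := c 1%nat) in *. set (w2 := c 2%nat) in *.
set (H := slope omega w1).
assert (HH := slope_pseries c omega r Hr Hc). fold w1 H in HH.
assert (Hsm : forall z, in_disk z -> smooth_at H z).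
{ intros z Hz. destruct (Ceq_dec z (RtoC 0)) as [->|Hne].
  - apply (smooth_of_pseries _ _ r Hr HH).
  - apply slope_smooth; [exact Hne | now apply analytic_smooth]. }
assert (HzH : forall z, (z * H z = omega z)%C).
{ intros z. unfold H, slope. destruct Ceq_dec as [->|Hne].
  - rewrite H0. ring.
  - rewrite H0. field. exact Hne. }
assert (H1 : H (RtoC 0) = w1).
{ unfold H, slope. destruct Ceq_dec; [reflexivity | congruence]. }
assert (Hb : forall z, in_disk z -> Cmod (H z) <= 1).
{ apply maximum_principle_open; [lra | exact Hsm|].
  intros z Hz. rewrite <- Cmod_mult, HzH. left. now apply Hdisk. }
exists w1, w2. split; [exact J|].
assert (Hw1 : Cmod w1 <= 1) by (rewrite <- H1; now apply Hb).
split; [exact Hw1|].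
apply limit_bound; [apply Cmod_ge_0 | apply pow2_ge_0|].
intros l Hl.
set (H2 := slope H w2).
assert (HH2 := slope_pseries _ H r Hr HH). fold w2 H2 in HH2.
set (den := fun z => (RtoC 1 + - (Cconj (RtoC l * w1)) * (RtoC l * H z))%C).
assert (Hden : forall z, in_disk z -> den z <> RtoC 0).
{ intros z Hz Habs. unfold den in Habs.
  assert (E : (Cconj (RtoC l * w1) * (RtoC l * H z))%C = RtoC 1).
  { symmetry. apply Cminus_eq_0. rewrite <- Habs. ring. }
  apply (f_equal Cmod) in E.
  rewrite Cmod_mult, Cmod_conj, !Cmod_mult, Cmod_1, Cmod_RtoC_pos in E by lra.
  assert (Hz' := Hb z Hz).
  generalize (Cmod_ge_0 w1) (Cmod_ge_0 (H z)). intros. 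
  assert (Cmod w1 * Cmod (H z) <= 1 * 1) by (apply Rmult_le_compat; lra).
  assert (0 <= Cmod w1 * Cmod (H z)) by (apply Rmult_le_pos; lra).
  nra. }
set (Q := fun z => (RtoC l * H2 z * / den z)%C).
assert (HQ : Cmod (Q (RtoC 0)) <= 1).
{ apply maximum_principle_open; [lra | | | exact D0].
  - intros z Hz. apply smooth_mult.
    + apply smooth_mult; [apply smooth_const|].
      destruct (Ceq_dec z (RtoC 0)) as [->|Hne].
      * apply (smooth_of_pseries _ _ r Hr HH2).
      * apply slope_smooth; [exact Hne | now apply Hsm].
    + apply smooth_inv; [now apply Hden|].
      apply smooth_plus; [apply smooth_const|].
      apply smooth_mult; [apply smooth_const|].
      apply smooth_mult; [apply smooth_const | now apply Hsm].
  - intros z Hz.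
    assert (EQ : (z * Q z = (RtoC l * H z - RtoC l * w1) / den z)%C).
    { unfold Q, H2, slope. destruct Ceq_dec as [->|Hne].
      - rewrite H1. field. now apply Hden.
      - rewrite H1. field. split; [now apply Hden | exact Hne]. }
    rewrite <- Cmod_mult, EQ, Cmod_div by now apply Hden.
    apply Rle_div_l; [apply Cmod_gt_0; now apply Hden|].
    rewrite Rmult_1_l.
    replace (den z) with (RtoC 1 - Cconj (RtoC l * w1) * (RtoC l * H z))%C
      by (unfold den; ring).
    apply disk_automorphism_bound; rewrite Cmod_mult, Cmod_RtoC_pos by lra.
    + assert (Hz' := Hb z Hz). generalize (Cmod_ge_0 (H z)). nra.
    + generalize (Cmod_ge_0 w1). nra. }
assert (Hden0 : den (RtoC 0) = RtoC (1 - l ^ 2 * Cmod w1 ^ 2)).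
{ unfold den. rewrite H1, Cmult_conj, Cmod2_alt. destruct w1 as [x y].
  unfold Cplus, Cmult, Copp, Cconj, RtoC, Re, Im; simpl. f_equal; ring. }
assert (HH20 : H2 (RtoC 0) = w2).
{ unfold H2, slope. destruct Ceq_dec; [reflexivity | congruence]. }
assert (Hpos : 0 < 1 - l ^ 2 * Cmod w1 ^ 2).
{ generalize (Cmod_ge_0 w1). intros. assert (Cmod w1 ^ 2 <= 1) by nra.
  assert (0 <= Cmod w1 ^ 2) by apply pow2_ge_0. assert (l ^ 2 < 1) by nra. nra. }
unfold Q in HQ. rewrite Hden0, HH20, !Cmod_mult, Cmod_inv in HQ
  by (apply RtoC_neq_0; lra).
rewrite !Cmod_RtoC_pos in HQ by lra.
apply (proj1 (Rle_div_l _ _ _ Hpos)) in HQ. lra.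
Qed.

(** * The lower bound of the determinant *)

Lemma jet_derive : forall f z0 c0 c1 c2,
  jet (fun h => f (z0 + h)%C) c0 c1 c2 -> C_derive f z0 = c1.
Proof.
intros f z0 c0 c1 c2 J. apply is_C_derive_unique.
assert (E0 := jet_0 _ _ _ _ J). cbv beta in E0.
replace (z0 + 0)%C with z0 in E0 by ring.
destruct J as [e [He HF]].
assert (Hb : bounded_near0 (fun h => c2 + h * e h)%C) by bounded.
split; [apply is_linear_scal_l|].
intros z Hz.
assert (Ez : z = z0).
{ symmetry. apply (@is_filter_lim_locally_unique C_AbsRing
    (AbsRing_NormedModule C_AbsRing)). exact Hz. }
subst z. intros eps.
destruct (near0_and _ _ HF (bounded_small _ Hb eps (cond_pos eps))) as [d [Hd H]].
assert (Hmain : forall w : C, Cmod (w - z0) < d ->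
  Cmod ((f w - f z0) - (w - z0) * c1)%C <= eps * Cmod (w - z0)).
{ intros w Hw. destruct (H _ Hw) as [H1 H2].
  replace (z0 + (w - z0))%C with w in H1 by ring.
  rewrite E0, H1.
  match goal with |- Cmod ?x <= _ => replace x with
    ((w - z0) * (c2 + (w - z0) * e (w - z0)%C) * (w - z0))%C by ring end.
  rewrite Cmod_mult. apply Rmult_le_compat_r; [apply Cmod_ge_0 | lra]. }
exists (mkposreal d Hd). exact Hmain.
Qed.

Lemma expansion_derive : forall f a z, expansion f a -> in_disk z ->
  C_derive f z = pseries (fun n => RtoC (INR (S n)) * a (S n))%C z.
Proof.
intros f a z Hf Hz.
destruct (expansion_recenter f a z Hf Hz) as [r [Hr H]].
rewrite (jet_derive _ _ _ _ _ (jet_of_series_at _ f z r Hr H)).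
apply taylor_coef_1; [now apply expansion_tame with f | exact Hz].
Qed.

Lemma expansion_jet : forall f a, expansion f a ->
  jet f (a 0%nat) (a 1%nat) (a 2%nat).
Proof. intros f a Hf. apply jet_pseries with 1; [lra | exact Hf]. Qed.

(** With f = z F, the equation z f' / f = phi o omega reads f' = F (phi o omega), where all
    three functions have jets at 0; the coefficients are compared up to order 2. *)
Lemma class_S_coefficients : forall phi (B : nat -> C) f a,
  expansion phi B -> phi (RtoC 0) = RtoC 1 ->
  class_S phi f -> expansion f a ->
  exists w1 w2 : C, Cmod w1 <= 1 /\ Cmod w2 <= 1 - Cmod w1 ^ 2 /\
    a 2%nat = (B 1%nat * w1)%C /\
    (a 3%nat + a 3%nat
     = B 1%nat * w2 + (B 1%nat * B 1%nat + B 2%nat) * (w1 * w1))%C.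
Proof.
intros phi B f a Hphi Hphi0 [[_ [a' [Hfa' [Ha'0 Ha'1]]]] [Hf0 [omega [Han [Hom [Hom0 Hsub]]]]]] Hfa.
destruct (jet_unique _ _ _ _ _ _ _ (expansion_jet f a Hfa) (expansion_jet f a' Hfa'))
  as [E0 [E1 _]].
rewrite Ha'0 in E0. rewrite Ha'1 in E1. clear a' Hfa' Ha'0 Ha'1.
destruct (schwarz_pick_coefficients omega Han Hom Hom0) as [w1 [w2 [Jom [Hw1 Hw2]]]].
exists w1, w2. split; [exact Hw1|]. split; [exact Hw2|].
assert (B0 : B 0%nat = RtoC 1).
{ rewrite <- Hphi0. symmetry. apply (jet_0 _ _ _ _ (expansion_jet _ _ Hphi)). }
assert (Ha := expansion_tame f a Hfa).
set (F := pseries (fun n => a (S n))).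
assert (HF := tame_expansion _ (tame_tail a Ha)). fold F in HF.
assert (HfF : forall z, in_disk z -> f z = (z * F z)%C).
{ intros z Hz. apply (Cpseries_unique a z); [now apply Hfa|].
  replace (z * F z)%C with (a 0%nat + z * F z)%C by (rewrite E0; ring).
  apply Cpseries_tail. now apply HF. }
assert (JF := expansion_jet F _ HF).
assert (JP := jet_comp _ _ _ _ _ _ _ (expansion_jet phi B Hphi) Jom).
assert (JL := jet_mult _ _ _ _ _ _ _ _ JF JP).
assert (JR := expansion_jet _ _ (tame_expansion _ (tame_linear _ (tame_tail a Ha)))).
assert (Heq : near0 (fun z => (F z * phi (omega z))%C
   = pseries (fun n => RtoC (INR (S n)) * a (S n))%C z)).
{ exists 1. split; [lra|]. intros z Hz. rewrite <- (expansion_derive f a z Hfa Hz).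
  destruct (Ceq_dec z (RtoC 0)) as [->|Hne].
  - rewrite (expansion_derive f a _ Hfa Hz), Hom0, Hphi0.
    rewrite (pseries_unique _ _ _ (Cpseries_0 _)).
    rewrite (jet_0 _ _ _ _ JF). simpl. ring.
  - rewrite <- Hsub by exact Hz. unfold log_deriv.
    destruct Ceq_dec as [|_]; [contradiction|].
    assert (HFz : F z <> RtoC 0).
    { intros E. apply (Hf0 z Hz Hne). rewrite HfF, E by exact Hz. ring. }
    rewrite (HfF z Hz). field. now split. }
destruct (jet_unique _ _ _ _ _ _ _ (jet_ext _ _ _ _ _ Heq JL) JR) as [_ [U1 U2]].
rewrite B0, E1 in U1, U2. simpl INR in U1, U2.
assert (G1 : a 2%nat = (B 1%nat * w1)%C).
{ apply Cminus_eq_0.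
  transitivity (RtoC (1 + 1) * a 2%nat - (RtoC 1 * (B 1%nat * w1) + a 2%nat * RtoC 1))%C.
  - rewrite RtoC_plus. ring.
  - rewrite U1. ring. }
split; [exact G1|].
rewrite G1 in U2. apply Cminus_eq_0.
match type of U2 with ?l = ?r => transitivity (r - l)%C end.
- rewrite !RtoC_plus. ring.
- rewrite U2. ring.
Qed.

(** The determinant when |w1|^2 = t, |w2| = 1 - t and w2 points in the direction of - w1^2,
    the worst case for given t. *)
Definition lower_envelope (B1 B2 t : R) : R :=
  1 - B1 ^ 2 / 4 - B1 * (B1 ^ 2 + 3 * B1 - B2) / 2 * t
  + ((3 * B1 ^ 2 - B2) * (B1 ^ 2 + B2) + B1 * (2 * B1 ^ 2 - 2 * B2 - B1)) / 4 * t ^ 2.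

Lemma det_lower_envelope : forall (B1 B2 : R) (a : nat -> C) (w1 w2 : C),
  0 <= B1 -> B2 <= B1 ^ 2 ->
  Cmod w1 <= 1 -> Cmod w2 <= 1 - Cmod w1 ^ 2 ->
  a 2%nat = (RtoC B1 * w1)%C ->
  (a 3%nat + a 3%nat = RtoC B1 * w2 + (RtoC B1 * RtoC B1 + RtoC B2) * (w1 * w1))%C ->
  lower_envelope B1 B2 (Cmod w1 ^ 2) <= Re (det_T31 a).
Proof.
intros B1 B2 a w1 w2 HB1 HB2 Hw1 Hw2 E2 E3.
set (t := Cmod w1 ^ 2) in *.
set (S := Re (w1 * w1 * Cconj w2)%C).
assert (HS : - (t * (1 - t)) <= S).
{ assert (H : Rabs S <= t * (1 - t)).
  { unfold S. eapply Rle_trans; [apply re_le_Cmod|].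
    rewrite !Cmod_mult, Cmod_conj. unfold t at 1.
    replace (Cmod w1 ^ 2) with (Cmod w1 * Cmod w1) by ring.
    apply Rmult_le_compat_l; [|exact Hw2].
    generalize (Cmod_ge_0 w1). nra. }
  apply Rabs_le_between in H. lra. }
assert (Hw22 : Cmod w2 ^ 2 <= (1 - t) ^ 2)
  by (apply pow_incr; split; [apply Cmod_ge_0 | exact Hw2]).
assert (E : Re (det_T31 a) = 1 - 2 * B1 ^ 2 * t
  + (B1 ^ 2 * (B1 ^ 2 + B2) - (B1 ^ 2 + B2) ^ 2 / 4) * t ^ 2
  + B1 * (B1 ^ 2 - B2) / 2 * S - B1 ^ 2 / 4 * Cmod w2 ^ 2).
{ rewrite det_T31_real, E2, !Cmod2_alt. unfold t, S. rewrite !Cmod2_alt.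
  destruct (a 3%nat) as [u v]. destruct w1 as [x y], w2 as [p q].
  injection E3. unfold RtoC, Cplus, Cmult, Cconj, Re, Im; simpl. intros Hv Hu.
  match type of Hu with _ = ?U => assert (u = U / 2) by lra end.
  match type of Hv with _ = ?V => assert (v = V / 2) by lra end.
  subst u v. field. }
rewrite E. unfold lower_envelope.
assert (0 <= B1 * (B1 ^ 2 - B2) / 2 * (S + t * (1 - t))).
{ apply Rmult_le_pos; [|lra]. assert (0 <= B1 * (B1 ^ 2 - B2)) by nra. lra. }
assert (0 <= B1 ^ 2 / 4 * ((1 - t) ^ 2 - Cmod w2 ^ 2)).
{ apply Rmult_le_pos; [|lra]. generalize (pow2_ge_0 B1). lra. }
nra.
Qed.

(** * Products of power series and exponentials *)

Lemma Re_Csum : forall (a : nat -> C) n, Re (Csum a n) = sum_f_R0 (fun k => Re (a k)) n.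
Proof.
intros a n; induction n as [|n IH].
- now rewrite Csum_O.
- rewrite Csum_Sn. simpl. now rewrite <- IH.
Qed.

Lemma Im_Csum : forall (a : nat -> C) n, Im (Csum a n) = sum_f_R0 (fun k => Im (a k)) n.
Proof.
intros a n; induction n as [|n IH].
- now rewrite Csum_O.
- rewrite Csum_Sn. simpl. now rewrite <- IH.
Qed.

Lemma Cseries_Re : forall (a : nat -> C) (l : C),
  Cseries a l -> is_series (fun n => Re (a n)) (Re l).
Proof.
intros a l H. apply is_series_Reals. intros eps Heps.
destruct (proj1 (Cseries_eps a l) H eps Heps) as [N HN].
exists N. intros n Hn. unfold R_dist. rewrite <- Re_Csum.
eapply Rle_lt_trans; [|apply (HN n Hn)].
apply (re_le_Cmod (Csum a n - l)%C).
Qed.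

Lemma Cseries_Im : forall (a : nat -> C) (l : C),
  Cseries a l -> is_series (fun n => Im (a n)) (Im l).
Proof.
intros a l H. apply is_series_Reals. intros eps Heps.
destruct (proj1 (Cseries_eps a l) H eps Heps) as [N HN].
exists N. intros n Hn. unfold R_dist. rewrite <- Im_Csum.
eapply Rle_lt_trans; [|apply (HN n Hn)].
apply (im_le_Cmod (Csum a n - l)%C).
Qed.

Lemma Cseries_Re_Im : forall (a : nat -> C) (l : C),
  is_series (fun n => Re (a n)) (Re l) -> is_series (fun n => Im (a n)) (Im l) ->
  Cseries a l.
Proof.
intros a l HR HI. apply is_series_Reals in HR. apply is_series_Reals in HI.
apply Cseries_eps. intros eps Heps.
destruct (HR (eps / 2)) as [N HN]; [lra|].
destruct (HI (eps / 2)) as [M HM]; [lra|].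
exists (max N M). intros n Hn.
specialize (HN n ltac:(lia)). specialize (HM n ltac:(lia)).
unfold R_dist in HN, HM. rewrite <- Re_Csum in HN. rewrite <- Im_Csum in HM.
eapply Rle_lt_trans; [apply Cmod_le_Re_Im|].
change (Re (Csum a n - l)%C) with (Re (Csum a n) - Re l).
change (Im (Csum a n - l)%C) with (Im (Csum a n) - Im l). lra.
Qed.

Definition convolution (a b : nat -> C) (n : nat) : C :=
  Csum (fun k => a k * b (n - k)%nat)%C n.

Lemma geometric_Rabs : forall (u : nat -> R) K q, 0 <= q < 1 ->
  (forall n, Rabs (u n) <= K * q ^ n) -> ex_series (fun n => Rabs (u n)).
Proof.
intros u K q Hq Hu.
apply (@ex_series_le R_AbsRing R_CompleteNormedModule _ (fun n => K * q ^ n)).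
- intros n. change (Rabs (Rabs (u n)) <= K * q ^ n). now rewrite Rabs_Rabsolu.
- exists (K * / (1 - q)).
  apply (@is_series_scal R_AbsRing R_NormedModule).
  apply is_series_geom. rewrite Rabs_pos_eq; lra.
Qed.

(** Mertens' theorem, reduced to the four real products of real and imaginary parts. *)
Lemma Cseries_convolution : forall (a b : nat -> C) (la lb : C) K L q,
  0 <= q < 1 -> (forall n, Cmod (a n) <= K * q ^ n) ->
  (forall n, Cmod (b n) <= L * q ^ n) ->
  Cseries a la -> Cseries b lb -> Cseries (convolution a b) (la * lb)%C.
Proof.
intros a b la lb K L q Hq Ka Lb Ha Hb.
assert (Hre : forall (c : nat -> C) M, (forall n, Cmod (c n) <= M * q ^ n) ->
  ex_series (fun n => Rabs (Re (c n))) /\ ex_series (fun n => Rabs (Im (c n)))).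
{ intros c M Hc. split; apply (geometric_Rabs _ M q Hq); intros n;
    (eapply Rle_trans; [|apply Hc]); [apply re_le_Cmod | apply im_le_Cmod]. }
destruct (Hre a K Ka) as [A1 A2]. destruct (Hre b L Lb) as [B1 B2].
assert (RA := Cseries_Re a la Ha). assert (IA := Cseries_Im a la Ha).
assert (RB := Cseries_Re b lb Hb). assert (IB := Cseries_Im b lb Hb).
apply Cseries_Re_Im.
- assert (H := is_series_minus _ _ _ _
    (is_series_mult _ _ _ _ RA RB A1 B1) (is_series_mult _ _ _ _ IA IB A2 B2)).
  revert H. apply is_series_ext. intros n.
  unfold convolution. rewrite Re_Csum.
  change (plus ?x (opp ?y)) with (x - y). rewrite <- minus_sum.
  apply sum_eq. intros k _. reflexivity.
- assert (H := is_series_plus _ _ _ _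
    (is_series_mult _ _ _ _ RA IB A1 B2) (is_series_mult _ _ _ _ IA RB A2 B1)).
  revert H. apply is_series_ext. intros n.
  unfold convolution. rewrite Im_Csum.
  change (plus ?x ?y) with (x + y). rewrite <- plus_sum.
  apply sum_eq. intros k _. reflexivity.
Qed.

Lemma Csum_ext : forall (a b : nat -> C) n,
  (forall k, (k <= n)%nat -> a k = b k) -> Csum a n = Csum b n.
Proof. intros a b n H. now apply (@sum_n_ext_loc C_AbelianMonoid). Qed.

Lemma Csum_scal : forall (c : C) (a : nat -> C) n,
  Csum (fun k => c * a k)%C n = (c * Csum a n)%C.
Proof. intros c a n. apply (@sum_n_mult_l C_Ring). Qed.

Lemma Cpseries_convolution : forall (a b : nat -> C) (z la lb : C),
  tame a -> tame b -> in_disk z -> Cpseries a z la -> Cpseries b z lb ->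
  Cpseries (convolution a b) z (la * lb)%C.
Proof.
intros a b z la lb Ha Hb Hz Hla Hlb. unfold in_disk in Hz.
generalize (Cmod_ge_0 z); intros H0.
set (r := (1 + Cmod z) / 2).
assert (Hr : Cmod z < r < 1) by (unfold r; lra).
destruct (Ha r) as [K HK]; [lra|]. destruct (Hb r) as [L HL]; [lra|].
apply Cseries_of_pseries in Hla. apply Cseries_of_pseries in Hlb. apply Cpseries_of_series.
assert (H := Cseries_convolution _ _ _ _ K L (Cmod z / r)
  (ratio_bounds z r (proj1 Hr))
  (fun n => geometrically_bounded_terms a r K z n ltac:(lra) HK)
  (fun n => geometrically_bounded_terms b r L z n ltac:(lra) HL) Hla Hlb).
revert H. apply Cseries_ext. intros n. unfold convolution.
rewrite Cmult_comm, <- Csum_scal. apply Csum_ext. intros k Hk.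
replace (z ^ n)%C with (z ^ k * z ^ (n - k))%C.
- ring.
- rewrite <- Cpow_add_r. f_equal. lia.
Qed.

(** The identity theorem at 0, by induction on the index: the tail of a series that sums to 0
    vanishes off 0 by division, and at 0 because its constant term is the first-order
    coefficient of the jet of the zero function. *)
Lemma Cpseries_zero : forall n (c : nat -> C), tame c ->
  (forall z, in_disk z -> Cpseries c z (RtoC 0)) -> c n = RtoC 0.
Proof.
induction n as [|n IH]; intros c Hc H.
- apply (Cpseries_unique c (RtoC 0)); [apply Cpseries_0|].
  apply H. unfold in_disk. rewrite Cmod_0. lra.
- assert (J := jet_pseries c (fun _ => RtoC 0) 1 ltac:(lra) H).
  destruct (jet_unique _ _ _ _ _ _ _ J (jet_const (RtoC 0))) as [E0 [E1 _]].
  apply (IH (fun n => c (S n))); [now apply tame_tail|].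
  intros z Hz. destruct (Ceq_dec z (RtoC 0)) as [->|Hne].
  + assert (H1 := Cpseries_0 (fun n => c (S n))). cbv beta in H1.
    now rewrite E1 in H1.
  + replace (RtoC 0) with ((RtoC 0 - c 0%nat) / z)%C
      by (rewrite E0; field; exact Hne).
    apply Cpseries_tail_inv; [exact Hne | now apply H].
Qed.

Lemma bounded_prefix : forall (u : nat -> R) N, exists M, 0 <= M /\
  forall n, (n <= N)%nat -> u n <= M.
Proof.
intros u N; induction N as [|N [M [HM0 HM]]].
- exists (Rabs (u 0%nat)). split; [apply Rabs_pos|]. intros n Hn.
  replace n with 0%nat by lia. apply Rle_abs.
- exists (Rmax M (u (S N))). generalize (Rmax_l M (u (S N))) (Rmax_r M (u (S N))).
  intros H1 H2. split; [lra|]. intros n Hn.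
  destruct (Nat.eq_dec n (S N)) as [->|Hne]; [exact H2|].
  specialize (HM n ltac:(lia)). lra.
Qed.

Section Exponential.

Variable p : nat -> C.

(** The recursion refers to all earlier coefficients, so it is run on functions that are
    correct up to index n. Beyond n the value is a copy of the one at n and is never read. *)
Fixpoint exp_prefix (n : nat) : nat -> C :=
  match n with
  | O => fun _ => RtoC 1
  | S m => fun k => if (k <=? m)%nat then exp_prefix m k else
      (convolution (fun i => p (S i)) (exp_prefix m) m / RtoC (INR (S m)))%C
  end.

(** The coefficients of exp(p_1 z + p_2 z^2 / 2 + p_3 z^3 / 3 + ...). *)
Definition exp_coef (n : nat) : C := exp_prefix n n.

Lemma exp_prefix_stable : forall n k, (k <= n)%nat -> exp_prefix n k = exp_coef k.
Proof.
induction n as [|n IH]; intros k Hk.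
- now replace k with 0%nat by lia.
- destruct (Nat.eq_dec k (S n)) as [->|Hne]; [reflexivity|].
  simpl. rewrite (proj2 (Nat.leb_le k n)) by lia. apply IH. lia.
Qed.

Lemma exp_coef_0 : exp_coef 0 = RtoC 1.
Proof. reflexivity. Qed.

Lemma exp_coef_rec : forall n,
  (RtoC (INR (S n)) * exp_coef (S n))%C = convolution (fun i => p (S i)) exp_coef n.
Proof.
intros n. unfold exp_coef at 1. cbn [exp_prefix].
rewrite (proj2 (Nat.leb_gt (S n) n)) by lia.
replace (convolution (fun i => p (S i)) (exp_prefix n) n)
  with (convolution (fun i => p (S i)) exp_coef n).
- field. apply RtoC_neq_0, not_0_INR. lia.
- apply Csum_ext. intros k Hk. rewrite exp_prefix_stable; [reflexivity | lia].
Qed.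

(** If T bounds the sums of |p_(k+1)| r^(k+1), then the recursion gives
    (n+1) |e_(n+1)| r^(n+1) <= T max_(k<=n) |e_k| r^k, so that the maximum stops growing
    once n + 1 >= T. *)
Lemma exp_coef_tame : tame p -> tame exp_coef.
Proof.
intros Hp r Hr. set (s := (1 + r) / 2).
assert (Hs : r < s < 1) by (unfold s; lra).
destruct (Hp s) as [K HK]; [lra|].
assert (Hq : 0 <= r / s < 1).
{ split; [apply Rdiv_le_0_compat; lra | apply Rlt_div_l; lra]. }
assert (K0 : 0 <= K).
{ generalize (HK 0%nat) (Cmod_ge_0 (p 0%nat)). simpl. lra. }
set (T := K * / (1 - r / s)).
assert (HT : 0 <= T).
{ apply Rmult_le_pos; [exact K0|]. left; apply Rinv_0_lt_compat; lra. }
destruct (INR_unbounded T) as [N HN].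
destruct (bounded_prefix (fun n => Cmod (exp_coef n) * r ^ n) N) as [M [HM0 HM]].
exists M. intros n. induction n as [n IH] using (well_founded_induction Wf_nat.lt_wf).
destruct (Nat.le_gt_cases n N) as [Hn|Hn]; [now apply HM|].
destruct n as [|n]; [lia|].
assert (HSn : 0 < INR (S n)) by (apply lt_0_INR; lia).
assert (HTn : T <= INR (S n)).
{ apply Rle_trans with (INR N); [lra|]. apply le_INR. lia. }
assert (Hterm : forall k m, (k <= m)%nat -> (m <= n)%nat ->
  Cmod (p (S k) * exp_coef (n - k))%C * r ^ (S n) <= K * (r / s) ^ k * M).
{ intros k m Hk Hm. rewrite Cmod_mult.
  replace (S n) with (S k + (n - k))%nat by lia. rewrite pow_add.
  replace (Cmod (p (S k)) * Cmod (exp_coef (n - k)) * (r ^ S k * r ^ (n - k)))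
    with (Cmod (p (S k)) * r ^ S k * (Cmod (exp_coef (n - k)) * r ^ (n - k))) by ring.
  apply Rmult_le_compat.
  - apply Rmult_le_pos; [apply Cmod_ge_0 | apply pow_le; lra].
  - apply Rmult_le_pos; [apply Cmod_ge_0 | apply pow_le; lra].
  - apply Rle_trans with (K * (r / s) ^ S k).
    + replace (Cmod (p (S k)) * r ^ S k) with (Cmod (p (S k)) * s ^ S k * (r / s) ^ S k).
      * apply Rmult_le_compat_r; [apply pow_le; lra | apply HK].
      * unfold Rdiv. rewrite Rpow_mult_distr, pow_inv. field. apply pow_nonzero; lra.
    + apply Rmult_le_compat_l; [exact K0|]. simpl.
      assert (0 <= (r / s) ^ k) by (apply pow_le; lra). nra.
  - apply IH. lia. }
assert (Hsum : forall m, (m <= n)%nat ->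
  Cmod (Csum (fun k => p (S k) * exp_coef (n - k)%nat)%C m) * r ^ S n
    <= K * sum_f_R0 (fun k => (r / s) ^ k) m * M).
{ induction m as [|m IHm]; intros Hm.
  - rewrite Csum_O. simpl sum_f_R0. apply (Hterm 0%nat 0%nat); lia.
  - rewrite Csum_Sn. simpl sum_f_R0.
    apply Rle_trans with ((Cmod (Csum (fun k => p (S k) * exp_coef (n - k)%nat)%C m)
      + Cmod (p (S (S m)) * exp_coef (n - S m)%nat)%C) * r ^ S n).
    + apply Rmult_le_compat_r; [apply pow_le; lra | apply Cmod_triangle].
    + rewrite Rmult_plus_distr_r, Rmult_plus_distr_l, Rmult_plus_distr_r.
      apply Rplus_le_compat; [apply IHm; lia|].
      apply (Hterm (S m) (S m)); lia. }
specialize (Hsum n (le_n n)). fold (convolution (fun i => p (S i)) exp_coef n) in Hsum.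
rewrite <- exp_coef_rec, Cmod_mult, Cmod_RtoC_pos in Hsum by lra.
apply Rmult_le_reg_l with (INR (S n)); [exact HSn|].
rewrite <- Rmult_assoc. eapply Rle_trans; [exact Hsum|].
apply Rmult_le_compat_r; [exact HM0|].
apply Rle_trans with (2 := HTn). apply Rmult_le_compat_l; [exact K0|].
now apply geometric_sum_le.
Qed.

Lemma exp_coef_derivative : tame p -> forall z, in_disk z ->
  Cpseries (fun n => RtoC (INR (S n)) * exp_coef (S n))%C z
    (pseries (fun n => p (S n)) z * pseries exp_coef z)%C.
Proof.
intros Hp z Hz.
assert (He := exp_coef_tame Hp). assert (Hp' := tame_tail p Hp).
apply Cpseries_of_series, Cseries_ext with
  (fun n => convolution (fun i => p (S i)) exp_coef n * z ^ n)%C.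
- intros n. now rewrite exp_coef_rec.
- apply Cseries_of_pseries, Cpseries_convolution; trivial.
  + now apply tame_expansion.
  + now apply tame_expansion.
Qed.

End Exponential.

Lemma smooth_jet : forall f z, smooth_at f z ->
  exists c2, jet (fun h => f (z + h)%C) (f z) (C_derive f z) c2.
Proof.
intros f z [c1 [c2 J]]. exists c2. now rewrite (jet_derive _ _ _ _ _ J).
Qed.

Lemma C_derive_mult : forall f g z, smooth_at f z -> smooth_at g z ->
  C_derive (fun w => f w * g w)%C z = (f z * C_derive g z + C_derive f z * g z)%C.
Proof.
intros f g z Hf Hg.
destruct (smooth_jet f z Hf) as [c2 J]. destruct (smooth_jet g z Hg) as [d2 J'].
exact (jet_derive (fun w => f w * g w)%C _ _ _ _ (jet_mult _ _ _ _ _ _ _ _ J J')).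
Qed.

Lemma C_derive_id : forall z, C_derive (fun w => w) z = RtoC 1.
Proof.
intros z. apply (jet_derive (fun w => w) z z (RtoC 1) (RtoC 0)).
exists (fun _ => RtoC 0). split; [bounded|]. apply near0_true. intros h. ring.
Qed.

Lemma expansion_smooth : forall f a z, expansion f a -> in_disk z -> smooth_at f z.
Proof.
intros f a z Hf Hz. apply analytic_smooth; [|exact Hz].
now apply expansion_analytic with a.
Qed.

Lemma expansion_mult : forall f g a b, expansion f a -> expansion g b ->
  expansion (fun w => f w * g w)%C (convolution a b).
Proof.
intros f g a b Hf Hg z Hz.
apply Cpseries_convolution; auto; eapply expansion_tame; eassumption.
Qed.

Lemma tame_opp : forall a, tame a -> tame (fun n => - a n)%C.
Proof.
intros a Ha r Hr. destruct (Ha r Hr) as [K HK]. exists K.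
intros n. rewrite Cmod_opp. apply HK.
Qed.

Lemma pseries_opp : forall a z, tame a -> in_disk z ->
  pseries (fun n => - a n)%C z = (- pseries a z)%C.
Proof.
intros a z Ha Hz. apply pseries_unique, Cpseries_of_series.
assert (H := Cseries_of_pseries _ _ _ (tame_expansion a Ha z Hz)).
apply (Cseries_scal (- RtoC 1)%C) in H.
replace (- pseries a z)%C with (- RtoC 1 * pseries a z)%C by ring.
revert H. apply Cseries_ext. intros n. ring.
Qed.

Lemma exp_derive : forall p z, tame p -> in_disk z ->
  C_derive (pseries (exp_coef p)) z
    = (pseries (fun n => p (S n)) z * pseries (exp_coef p) z)%C.
Proof.
intros p z Hp Hz.
rewrite (expansion_derive _ _ z (tame_expansion _ (exp_coef_tame p Hp)) Hz).
apply pseries_unique. now apply exp_coef_derivative.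
Qed.

(** The logarithmic derivatives cancel, so the product has derivative 0. *)
Lemma exp_inverse : forall p z, tame p -> in_disk z ->
  (pseries (exp_coef p) z * pseries (exp_coef (fun n => - p n)) z = 1)%C.
Proof.
intros p z Hp Hz.
set (p' := (fun n => - p n)%C).
assert (Hp' : tame p') by now apply tame_opp.
assert (HE := tame_expansion _ (exp_coef_tame p Hp)).
assert (HG := tame_expansion _ (exp_coef_tame p' Hp')).
set (E := pseries (exp_coef p)) in *. set (G := pseries (exp_coef p')) in *.
assert (HEG := expansion_mult _ _ _ _ HE HG).
set (d := convolution (exp_coef p) (exp_coef p')) in *.
assert (Hd := expansion_tame _ _ HEG).
assert (Hd' : tame (fun n => RtoC (INR (S n)) * d (S n))%C)
  by exact (tame_linear _ (tame_tail d Hd)).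
assert (Hzero : forall n, d (S n) = RtoC 0).
{ intros n.
  assert (H : (RtoC (INR (S n)) * d (S n))%C = RtoC 0).
  { apply (Cpseries_zero n (fun n => RtoC (INR (S n)) * d (S n))%C Hd').
    intros w Hw. assert (Hs := tame_expansion _ Hd' w Hw).
    rewrite <- (expansion_derive _ _ w HEG Hw) in Hs.
    rewrite (C_derive_mult E G w (expansion_smooth E _ w HE Hw)
      (expansion_smooth G _ w HG Hw)) in Hs.
    unfold E, G in Hs. rewrite !exp_derive in Hs by assumption.
    assert (Hop : pseries (fun n => p' (S n)) w = (- pseries (fun n => p (S n)) w)%C)
      by exact (pseries_opp _ w (tame_tail p Hp) Hw).
    rewrite Hop in Hs.
    match type of Hs with Cpseries _ _ ?x => replace (RtoC 0) with x by ring end.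
    exact Hs. }
  apply (Cmult_reg_l (RtoC (INR (S n)))).
  - apply RtoC_neq_0, not_0_INR. lia.
  - rewrite H. ring. }
apply (Cpseries_unique d z); [now apply HEG|].
replace (RtoC 1) with (d 0%nat + z * 0)%C.
- apply Cpseries_tail, Cpseries_of_series.
  apply Cseries_ext with (fun n => RtoC 0 * d n * z ^ n)%C.
  + intros n. rewrite Hzero. ring.
  + assert (H := Cseries_scal (RtoC 0) _ _ (Cseries_of_pseries _ _ _ (HEG z Hz))).
    rewrite Cmult_0_l in H.
    revert H. apply Cseries_ext. intros n. ring.
- unfold d, convolution. rewrite Csum_O. simpl. rewrite !exp_coef_0. ring.
Qed.

(** * Functions with a prescribed logarithmic derivative *)

Lemma expansion_zero : expansion (fun _ => RtoC 0) (fun _ => RtoC 0).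
Proof.
intros z _. apply Cpseries_of_series, Cseries_eps. intros eps Heps.
exists 0%nat. intros n _.
replace (Csum _ n) with (RtoC 0).
- replace (0 - 0)%C with (RtoC 0) by ring. now rewrite Cmod_0.
- induction n as [|n IH].
  + rewrite Csum_O. ring.
  + rewrite Csum_Sn, <- IH. ring.
Qed.

Lemma expansion_id :
  expansion (fun z => z) (fun n => if (n =? 1)%nat then RtoC 1 else RtoC 0).
Proof.
intros z Hz.
assert (H := expansion_zero z Hz).
apply (Cpseries_tail (fun n => if (n =? 0)%nat then RtoC 1 else RtoC 0)) in H.
apply (Cpseries_tail (fun n => if (n =? 1)%nat then RtoC 1 else RtoC 0)) in H.
simpl in H. replace z with (0 + z * (1 + z * 0))%C at 2 by ring. exact H.
Qed.

Lemma expansion_square : forall phi a, expansion phi a ->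
  expansion (fun z => phi (z * z)%C)
    (fun n => if Nat.even n then a (Nat.div2 n) else RtoC 0).
Proof.
intros phi a H z Hz. unfold in_disk in Hz.
assert (Hzz : in_disk (z * z)%C).
{ unfold in_disk. rewrite Cmod_mult. generalize (Cmod_ge_0 z). nra. }
assert (Hs := Cseries_of_pseries _ _ _ (H _ Hzz)).
apply Cpseries_of_series, Cseries_eps. intros eps Heps.
destruct (proj1 (Cseries_eps _ _) Hs eps Heps) as [N HN].
set (b := fun n => ((if Nat.even n then a (Nat.div2 n) else RtoC 0) * z ^ n)%C).
assert (Hsum : forall n, Csum b n = Csum (fun k => a k * (z * z) ^ k)%C (Nat.div2 n)).
{ assert (Hboth : forall m,
    Csum b (2 * m) = Csum (fun k => a k * (z * z) ^ k)%C m /\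
    Csum b (S (2 * m)) = Csum (fun k => a k * (z * z) ^ k)%C m).
  { assert (Hb0 : forall m, b (S (2 * m)) = RtoC 0).
    { intros m. unfold b. rewrite Nat.even_succ, Nat.odd_mul. simpl. ring. }
    assert (Hb1 : forall m, b (2 * m)%nat = (a m * (z * z) ^ m)%C).
    { intros m. unfold b. rewrite Nat.even_mul, Nat.div2_double. simpl orb.
      rewrite Cpow_mult_l, <- Cpow_add_r. do 2 f_equal. lia. }
    induction m as [|m [_ IH]].
    - simpl (2 * 0)%nat. rewrite Csum_Sn, !Csum_O.
      rewrite (Hb1 0%nat : b 0%nat = _), (Hb0 0%nat : b 1%nat = _).
      split; [reflexivity | apply Cplus_0_r].
    - assert (E : Csum b (2 * S m) = Csum (fun k => a k * (z * z) ^ k)%C (S m)).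
      { replace (2 * S m)%nat with (S (S (2 * m))) by lia.
        rewrite (Csum_Sn b (S (2 * m))), IH, (Csum_Sn _ m).
        replace (S (S (2 * m))) with (2 * S m)%nat by lia. now rewrite Hb1. }
      split; [exact E|]. rewrite Csum_Sn, E, Hb0. apply Cplus_0_r. }
  intros n. destruct (Nat.Even_or_Odd n) as [[m ->]|[m ->]].
  - rewrite Nat.div2_double. apply Hboth.
  - replace (2 * m + 1)%nat with (S (2 * m)) by lia.
    rewrite Nat.div2_succ_double. apply Hboth. }
exists (2 * N)%nat. intros n Hn. fold b. rewrite Hsum. apply HN.
rewrite Nat.div2_div. apply Nat.div_le_lower_bound; lia.
Qed.

(** The function is f = z E with E the exponential of the integral of
    (phi(omega(z)) - 1) / z. *)
Lemma class_S_construct : forall phi omega p,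
  analytic_on_disk omega ->
  (forall z, in_disk z -> in_disk (omega z)) ->
  omega (RtoC 0) = RtoC 0 ->
  expansion (fun z => phi (omega z)) p -> p 0%nat = RtoC 1 ->
  exists f a, class_S phi f /\ expansion f a /\
    a 2%nat = p 1%nat /\ (a 3%nat + a 3%nat = p 2%nat + p 1%nat * p 1%nat)%C.
Proof.
intros phi omega p Han Hdisk H0 Hp Hp0.
assert (Ht := expansion_tame _ _ Hp).
set (e := exp_coef p).
assert (HE := tame_expansion e (exp_coef_tame p Ht)).
set (E := pseries e) in *.
assert (HEne : forall z, in_disk z -> E z <> RtoC 0).
{ intros z Hz Habs. assert (H := exp_inverse p z Ht Hz). fold e E in H.
  rewrite Habs, Cmult_0_l in H. apply RtoC_inj in H. lra. }
set (f := fun z => (z * E z)%C).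
set (a := fun n => match n with O => RtoC 0 | S m => e m end).
assert (Hf : expansion f a).
{ intros z Hz. unfold f. replace (z * E z)%C with (a 0%nat + z * E z)%C
    by (unfold a; ring).
  apply Cpseries_tail. now apply HE. }
assert (Hr0 : e 0%nat = RtoC 1) by reflexivity.
assert (Hr1 : e 1%nat = p 1%nat).
{ assert (H := exp_coef_rec p 0). unfold convolution in H. rewrite Csum_O in H.
  simpl in H. fold e in H. rewrite Hr0 in H.
  transitivity (1 * e 1%nat)%C; [ring|]. rewrite H. ring. }
assert (Hr2 : (e 2%nat + e 2%nat = p 2%nat + p 1%nat * p 1%nat)%C).
{ assert (H := exp_coef_rec p 1). unfold convolution in H. rewrite Csum_Sn, Csum_O in H.
  simpl in H. fold e in H. rewrite Hr0, Hr1, RtoC_plus in H.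
  transitivity ((1 + 1) * e 2%nat)%C; [ring|]. rewrite H. ring. }
exists f, a. split; [|split; [exact Hf|now split]].
split; [|split].
- split; [now apply expansion_analytic with a|].
  exists a. now repeat split.
- intros z Hz Hne. unfold f. apply Cmult_neq_0; [exact Hne | now apply HEne].
- exists omega. split; [exact Han|]. split; [exact Hdisk|]. split; [exact H0|].
  intros z Hz.
  assert (Hpz : phi (omega z) = (1 + z * pseries (fun n => p (S n)) z)%C).
  { apply (Cpseries_unique p z); [now apply Hp|]. rewrite <- Hp0.
    apply Cpseries_tail. exact (tame_expansion _ (tame_tail p Ht) z Hz). }
  unfold log_deriv. destruct Ceq_dec as [->|Hne].
  + rewrite Hpz. ring.
  + assert (Hd : C_derive f z = (z * C_derive E z + 1 * E z)%C).
    { rewrite <- (C_derive_id z) at 1. apply (C_derive_mult (fun w => w) E).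
      - apply smooth_id.
      - now apply expansion_smooth with e. }
    assert (HdE := exp_derive p z Ht Hz). fold e E in HdE.
    rewrite Hd, HdE, Hpz. unfold f. field. split; [now apply HEne | exact Hne].
Qed.

(** * Extremal values *)

Lemma Ma_Minda_B1_pos : forall phi B, Ma_Minda phi ->
  expansion phi (fun n => RtoC (B n)) -> 0 < B 1%nat.
Proof.
intros phi B HM Hphi. destruct (MM_deriv0 phi HM) as [b [Hb Hd]].
apply is_C_derive_unique in Hd.
rewrite (expansion_derive _ _ _ Hphi) in Hd
  by (unfold in_disk; rewrite Cmod_0; lra).
rewrite (pseries_unique _ _ _ (Cpseries_0 _)) in Hd.
simpl in Hd. rewrite Cmult_1_l in Hd. apply RtoC_inj in Hd. now rewrite Hd.
Qed.

Lemma class_S_lower_envelope : forall phi B, Ma_Minda phi ->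
  expansion phi (fun n => RtoC (B n)) -> B 2%nat <= B 1%nat ^ 2 ->
  forall f a, class_S phi f -> expansion f a ->
  exists t, 0 <= t <= 1 /\ lower_envelope (B 1%nat) (B 2%nat) t <= Re (det_T31 a).
Proof.
intros phi B HM Hphi HB f a Hf Ha.
assert (HB1 := Ma_Minda_B1_pos phi B HM Hphi).
destruct (class_S_coefficients phi _ f a Hphi (MM_value0 phi HM) Hf Ha)
  as [w1 [w2 [Hw1 [Hw2 [E2 E3]]]]].
exists (Cmod w1 ^ 2). split.
- generalize (Cmod_ge_0 w1). intros. split; nra.
- apply (det_lower_envelope _ _ a w1 w2); trivial. lra.
Qed.

(** The extremal omega have real coefficients, which makes a_2 = p_1 and
    a_3 = (p_2 + p_1^2) / 2 real. *)
Lemma det_attains_of_coefficients : forall phi omega p m,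
  analytic_on_disk omega ->
  (forall z, in_disk z -> in_disk (omega z)) ->
  omega (RtoC 0) = RtoC 0 ->
  expansion (fun z => phi (omega z)) (fun n => RtoC (p n)) -> p 0%nat = 1 ->
  1 - 2 * p 1%nat ^ 2 + p 1%nat ^ 2 * (p 2%nat + p 1%nat ^ 2)
    - (p 2%nat + p 1%nat ^ 2) ^ 2 / 4 = m ->
  det_T31_attains phi m.
Proof.
intros phi omega p m Han Hdisk H0 Hp Hp0 <-.
destruct (class_S_construct phi omega _ Han Hdisk H0 Hp) as [f [a [Hf [Ha [E2 E3]]]]].
{ now rewrite Hp0. }
exists f, a. split; [exact Hf|]. split; [exact Ha|].
assert (E3' : a 3%nat = RtoC ((p 2%nat + p 1%nat ^ 2) / 2)).
{ apply (Cmult_reg_l (RtoC 2)); [apply RtoC_neq_0; lra|].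
  transitivity (a 3%nat + a 3%nat)%C; [ring|]. rewrite E3.
  rewrite <- !RtoC_mult, <- RtoC_plus. f_equal. field. }
rewrite det_T31_real, E2, E3', !Cmod2_alt.
unfold RtoC, Cconj, Cmult, Re, Im; simpl. field.
Qed.

(** The choice omega(z) = z makes |w1| = 1. *)
Lemma attains_envelope_1 : forall phi B, Ma_Minda phi ->
  expansion phi (fun n => RtoC (B n)) ->
  det_T31_attains phi (lower_envelope (B 1%nat) (B 2%nat) 1).
Proof.
intros phi B HM Hphi.
apply (det_attains_of_coefficients phi (fun z => z) B).
- apply expansion_analytic with (1 := expansion_id).
- trivial.
- reflexivity.
- exact Hphi.
- apply RtoC_inj. rewrite <- (MM_value0 phi HM).
  symmetry. apply (jet_0 _ _ _ _ (expansion_jet _ _ Hphi)).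
- unfold lower_envelope. field.
Qed.

(** The choice omega(z) = z^2 makes w1 = 0 and w2 = 1. *)
Lemma attains_envelope_0 : forall phi B, Ma_Minda phi ->
  expansion phi (fun n => RtoC (B n)) ->
  det_T31_attains phi (lower_envelope (B 1%nat) (B 2%nat) 0).
Proof.
intros phi B HM Hphi.
apply (det_attains_of_coefficients phi (fun z => z * z)%C
  (fun n => if Nat.even n then B (Nat.div2 n) else 0)).
- apply expansion_analytic with (1 := expansion_mult _ _ _ _ expansion_id expansion_id).
- intros z. unfold in_disk. rewrite Cmod_mult. generalize (Cmod_ge_0 z). nra.
- ring.
- intros z Hz. assert (H := expansion_square phi _ Hphi z Hz).
  apply Cseries_of_pseries in H. apply Cpseries_of_series.
  revert H. apply Cseries_ext. intros n. now destruct (Nat.even n).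
- apply RtoC_inj. rewrite <- (MM_value0 phi HM).
  symmetry. apply (jet_0 _ _ _ _ (expansion_jet _ _ Hphi)).
- unfold lower_envelope. simpl. field.
Qed.

Theorem theorem4 :
  forall (phi : C -> C) (B : nat -> R),
  Ma_Minda phi ->
  expansion phi (fun n => RtoC (B n)) ->
  let B1 := B 1%nat in
  let B2 := B 2%nat in
  B1 ^ 2 >= B2 ->
  (~ (0 <= mu B1 B2 <= 4) ->
     let m := Rmin (1 - B1 ^ 2 / 4)
                   (1 - 2 * B1 ^ 2 + 3 * B1 ^ 4 / 4 + B1 ^ 2 * B2 / 2 - B2 ^ 2 / 4) in
     det_T31_ge phi m /\ det_T31_attains phi m)
  /\
  (mu B1 B2 = 4 ->
     let m := 1 - 2 * B1 ^ 2 + 3 * B1 ^ 4 / 4 + B1 ^ 2 * B2 / 2 - B2 ^ 2 / 4 in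
     det_T31_ge phi m /\ det_T31_attains phi m)
  /\
  (0 < mu B1 B2 < 4 ->
     det_T31_ge phi
       (1 - B1 ^ 2 / 4
        - B1 ^ 2 * (B1 ^ 2 + 3 * B1 - B2) ^ 2 /
          (4 * (B1 * (2 * B1 ^ 2 - B1 - 2 * B2) + (3 * B1 ^ 2 - B2) * (B1 ^ 2 + B2))))).
Proof.
intros phi B HM Hphi B1 B2 HB.
assert (HB1 : 0 < B1) by exact (Ma_Minda_B1_pos phi B HM Hphi).
set (N := B1 ^ 2 + 3 * B1 - B2).
assert (HN : 0 < N) by (unfold N; lra).
set (D := (3 * B1 ^ 2 - B2) * (B1 ^ 2 + B2) + B1 * (2 * B1 ^ 2 - 2 * B2 - B1)).
assert (Hmu : mu B1 B2 = 4 * B1 * N / D) by reflexivity.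
assert (Hg : forall t, lower_envelope B1 B2 t
  = 1 - B1 ^ 2 / 4 - B1 * N / 2 * t + D / 4 * t ^ 2) by reflexivity.
assert (Hdet : forall m, (forall t, 0 <= t <= 1 -> m <= lower_envelope B1 B2 t) ->
  det_T31_ge phi m).
{ intros m Hm f a Hf Ha.
  destruct (class_S_lower_envelope phi B HM Hphi ltac:(fold B1 B2; lra) f a Hf Ha)
    as [t [Ht Hle]].
  specialize (Hm t Ht). fold B1 B2 in Hle. lra. }
assert (E0 : 1 - B1 ^ 2 / 4 = lower_envelope B1 B2 0) by (rewrite Hg; ring).
assert (E1 : 1 - 2 * B1 ^ 2 + 3 * B1 ^ 4 / 4 + B1 ^ 2 * B2 / 2 - B2 ^ 2 / 4
  = lower_envelope B1 B2 1) by (unfold lower_envelope; field).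
assert (A0 := attains_envelope_0 phi B HM Hphi). fold B1 B2 in A0.
assert (A1 := attains_envelope_1 phi B HM Hphi). fold B1 B2 in A1.
assert (HBN : 0 < B1 * N) by now apply Rmult_lt_0_compat.
assert (HD0 : mu B1 B2 <> 0 -> D <> 0).
{ intros Hne E. apply Hne. rewrite Hmu, E. unfold Rdiv. rewrite Rinv_0. ring. }
assert (HmuD : D <> 0 -> mu B1 B2 * D = 4 * (B1 * N)).
{ intros E. rewrite Hmu. field. exact E. }
rewrite E0, E1.
split; [|split].
- intros Hout. assert (Hne : D <> 0) by (apply HD0; intros Z; apply Hout; lra).
  specialize (HmuD Hne).
  (* The vertex B1 N / D is outside [0,1]: g is concave, or D < B1 N and g decreases on
     [0,1]. *)
  assert (HDout : D <= 0 \/ D < B1 * N).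
  { destruct (Rle_dec D 0); [now left | right].
    destruct (Rle_dec 0 (mu B1 B2)); [|nra].
    assert (4 < mu B1 B2) by lra. nra. }
  split.
  + apply Hdet. intros t Ht.
    destruct HDout as [HD|HD].
    * (* A concave function is above its chord. *)
      apply Rle_trans with ((1 - t) * lower_envelope B1 B2 0 + t * lower_envelope B1 B2 1).
      -- assert (H0 := Rmin_l (lower_envelope B1 B2 0) (lower_envelope B1 B2 1)).
         assert (H1 := Rmin_r (lower_envelope B1 B2 0) (lower_envelope B1 B2 1)).
         nra.
      -- rewrite !Hg. assert (0 <= t * (1 - t)) by nra. nra.
    * eapply Rle_trans; [apply Rmin_r|]. rewrite !Hg.
      assert (0 <= (1 - t) * (B1 * N - D)) by (apply Rmult_le_pos; lra).
      nra.
  + apply Rmin_case; assumption.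
- intros Hmu4. assert (Hne : D <> 0) by (apply HD0; intros Z; lra).
  assert (HD := HmuD Hne). rewrite Hmu4 in HD.
  split; [|exact A1].
  apply Hdet. intros t Ht. rewrite !Hg.
  assert (0 <= D / 4 * (t - 1) ^ 2) by (apply Rmult_le_pos; [lra | apply pow2_ge_0]).
  nra.
- intros Hin. assert (Hne : D <> 0) by (apply HD0; intros Z; lra). specialize (HmuD Hne).
  assert (HD : 0 < D) by (apply Rnot_le_lt; intros H; nra).
  apply Hdet. intros t Ht.
  replace (B1 * (2 * B1 ^ 2 - B1 - 2 * B2) + (3 * B1 ^ 2 - B2) * (B1 ^ 2 + B2))
    with D by (unfold D; ring).
  assert (E : lower_envelope B1 B2 t
    = lower_envelope B1 B2 0 - B1 ^ 2 * N ^ 2 / (4 * D) + D / 4 * (t - B1 * N / D) ^ 2).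
  { rewrite !Hg. field. lra. }
  rewrite E.
  assert (0 <= D / 4 * (t - B1 * N / D) ^ 2)
    by (apply Rmult_le_pos; [lra | apply pow2_ge_0]).
  lra.
Qed.
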